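(* Let $N\ge 1$, $\Delta\in\mathbb{R}$, and $Y=\{y_1<\dots<y_N\}\subset\mathbb{Z}$. For $\sigma\in\mathcal{S}_N$ (the group of permutations of $\{1,\dots,N\}$) define $$A_\sigma(\xi)=\prod\left\{S_{\beta\alpha}(\xi_\beta,\xi_\alpha): \{\beta,\alpha\}\text{ is an inversion in }\sigma\right\}.$$ Then the solution of the Schr\''odinger equation $i\,\partial_t\Psi_N=H_{XXZ}\Psi_N$, $\Psi_N(t)=\sum_{X}\psi_N(X;t)e_X$, satisfying the initial condition $\psi_N(X;0)=\delta_{X,Y}$, is given for $X=\{x_1<\dots<x_N\}\subset\mathbb{Z}$ by $$\psi_N(X;t)=\sum_{\sigma\in\mathcal{S}_N}\int_{\mathcal{C}_R}\cdots\int_{\mathcal{C}_R}A_\sigma(\xi)\prod_{i=1}^N\xi_{\sigma(i)}^{x_i}\prod_{i=1}^N\left(\xi_i^{-y_i-1}e^{-it\varepsilon(\xi_i)}\right)d\xi_1\cdots d\xi_N,$$ where $\mathcal{C}_R$ is the circle centered at zero with radius $R$ so large that all the poles of $A_\sigma$ lie inside $\mathcal{C}_R$.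
   Context: Let $\mathcal{X}_N$ be the set of all $X=\{x_1<\dots<x_N\}\subset\mathbb{Z}$ and $\mathcal{H}_N=\ell^2(\mathcal{X}_N)$ with orthonormal basis $\{e_X\}_{X\in\mathcal{X}_N}$, $e_X(Y)=\delta_{X,Y}$ ($e_X$ is the state with up-spins exactly at the sites of $X$). The Heisenberg-Ising (XXZ) spin-$\frac12$ Hamiltonian with anisotropy $\Delta\in\mathbb{R}$ is $H_{XXZ}=\sum_{j\in\mathbb{Z}}h_{j,j+1}$, where $h_{j,j+1}e_X=0$ if both or neither of $j,j+1$ belong to $X$, and $h_{j,j+1}e_X=-\Delta e_X+e_{X'}$ if exactly one of $j,j+1$ belongs to $X$, with $X'$ obtained from $X$ by exchanging the occupation of $j$ and $j+1$. It preserves $\mathcal{H}_N$ and is self-adjoint. $\varepsilon(\xi)=\xi+\xi^{-1}-2\Delta$, and $$S_{\beta\alpha}(\xi_\beta,\xi_\alpha)=-\frac{1+\xi_\alpha\xi_\beta-2\Delta\xi_\beta}{1+\xi_\alpha\xi_\beta-2\Delta\xi_\alpha}.$$ An inversion $\{\beta,\alpha\}$ in $\sigma$ is a pair with $\beta>\alpha$ and $\sigma^{-1}(\beta)<\sigma^{-1}(\alpha)$. All circles are positively oriented and every differential $d\xi$ incorporates the factor $(2\pi i)^{-1}$. ''All the poles of $A_\sigma$ lie inside $\mathcal{C}_R$'' means that the denominators $1+\xi_\alpha\xi_\beta-2\Delta\xi_\alpha$ of the $S$-factors are nonzero whenever $|\xi_\alpha|,|\xi_\beta|\ge R$. *)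

(* Defs.v *)
From HB Require Import structures.
From mathcomp Require Import all_boot all_order all_fingroup all_algebra.
From mathcomp Require Import finmap complex.
From mathcomp Require Import all_classical all_reals all_analysis.
Set Implicit Arguments.
Unset Strict Implicit.
Unset Printing Implicit Defensive.
Import Order.TTheory GRing.Theory Num.Theory.
Import numFieldTopology.Exports numFieldNormedType.Exports.
Local Open Scope classical_set_scope.
Local Open Scope complex_scope.
Local Open Scope ring_scope.

(* R[i] is the field of complex numbers over the real numbers R; [normc] is
   the modulus with values in R (the generic norm takes its values in R[i]). *)
Notation normc := ComplexField.Normc.normc.

Section Configurations.
Variable N : nat.

Definition config := {X : {fset int} | #|` X | == N}.

Definition occupied (X : config) (j : int) : bool := j \in val X.

(* the i-th smallest element of X, with indices starting at 0 *)
Definition site (X : config) (i : 'I_N) : int :=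
  nth 0 (sort <=%O (val X : seq int)) i.

Definition swap_int (j k : int) : int :=
  if k == j then j + 1 else if k == j + 1 then j else k.

Lemma swap_intK (j : int) : involutive (swap_int j).
Proof.
move=> k; rewrite /swap_int.
have jj : (j + 1 == j) = false by rewrite -subr_eq0 addrAC subrr add0r.
case: (eqVneq k j) => [->|kj]; first by rewrite jj eqxx.
case: (eqVneq k (j + 1)) => [->|kj1]; first by rewrite eqxx.
by rewrite (negbTE kj) (negbTE kj1).
Qed.

Lemma exchange_subproof (j : int) (X : config) :
  #|` (swap_int j @` val X)%fset | == N.
Proof.
by rewrite card_imfset ?(valP X) //; exact: (can_inj (@swap_intK j)).
Qed.

Definition exchange (j : int) (X : config) : config :=
  Sub (swap_int j @` val X)%fset (exchange_subproof j X).

Lemma exchangeK (j : int) : involutive (exchange j).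
Proof.
move=> X; apply/val_inj => /=; apply/fsetP => k.
rewrite -[k in LHS](swap_intK j) !mem_imfset //=;
  exact: (can_inj (@swap_intK j)).
Qed.

Lemma occupied_exchange (j k : int) (X : config) :
  occupied (exchange j X) k = occupied X (swap_int j k).
Proof.
rewrite /occupied /= -[k in LHS](swap_intK j) mem_imfset //=.
exact: (can_inj (@swap_intK j)).
Qed.

End Configurations.

Section Hamiltonian.
Variables (R : realType) (N : nat) (Delta : R).
Local Notation C := R[i].
Local Notation state := (config N -> C).

Definition basis_vec (X : config N) : state := fun Z => (X == Z)%:R.

(* the vector h_{j,j+1} e_X *)
Definition bond_basis (j : int) (X : config N) : state := fun Z =>
  if occupied X j == occupied X (j + 1) then 0
  else - Delta%:C * basis_vec X Z + basis_vec (exchange j X) Z.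

(* h_{j,j+1} psi = sum_X psi(X) h_{j,j+1} e_X, evaluated at Z; the sum has
   finite support, cf. bondE *)
Definition bond (j : int) (psi : state) : state := fun Z =>
  \sum_(X \in [set: config N]) psi X * bond_basis j X Z.

Lemma bondE (j : int) (psi : state) (Z : config N) :
  bond j psi Z = if occupied Z j == occupied Z (j + 1) then 0
                 else - Delta%:C * psi Z + psi (exchange j Z).
Proof.
have sw1 : swap_int j j = j + 1 by rewrite /swap_int eqxx.
have sw2 : swap_int j (j + 1) = j.
  by rewrite -[RHS](swap_intK j) sw1.
have exo X : (occupied (exchange j X) j == occupied (exchange j X) (j + 1))
             = (occupied X j == occupied X (j + 1)).
  by rewrite !occupied_exchange sw1 sw2 eq_sym.
have exE X : (exchange j X == Z) = (X == exchange j Z).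
  by apply/eqP/eqP => [<-|->]; rewrite exchangeK.
rewrite /bond (@fsbigTE _ _ _ _ [fset Z; exchange j Z]%fset); last first.
  move=> X; rewrite !inE negb_or => /andP[XZ XeZ].
  rewrite /bond_basis /basis_vec exE (negbTE XZ) (negbTE XeZ).
  by case: ifP => _; rewrite ?(mulr0, addr0).
case: (eqVneq (occupied Z j) (occupied Z (j + 1))) => [oZ|oZ].
  rewrite big1_seq // => X /=; rewrite !inE => /orP[]/eqP ->.
    by rewrite /bond_basis oZ eqxx mulr0.
  by rewrite /bond_basis exo oZ eqxx mulr0.
have ZeZ : Z != exchange j Z.
  apply: contra oZ => /eqP ZeZ.
  by rewrite [in X in X == _]ZeZ occupied_exchange sw1.
rewrite big_fsetU1 ?inE //= big_seq_fset1.
rewrite /bond_basis exo (negbTE oZ) /basis_vec exE eqxx exchangeK eqxx.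
rewrite [Z == exchange j Z](negbTE ZeZ).
by rewrite mulr0 addr0 mulr1 add0r mulr1 mulrC.
Qed.

Lemma bond_basisE (j : int) (X : config N) : bond j (basis_vec X) = bond_basis j X.
Proof.
apply/funext => Z; rewrite /bond (@fsbigTE _ _ _ _ [fset X]%fset).
  by rewrite big_seq_fset1 /basis_vec eqxx mul1r.
by move=> W; rewrite !inE => WX; rewrite /basis_vec eq_sym (negbTE WX) mul0r.
Qed.

(* the sum has finite support, cf. bond_finite_support *)
Definition Hxxz (psi : state) : state := fun Z =>
  \sum_(j \in [set: int]) bond j psi Z.

Lemma bond_finite_support (psi : state) (Z : config N) :
  finite_set [set j : int | bond j psi Z != 0].
Proof.
apply: (@sub_finite_set _ _
  ([set` val Z] `|` (fun k : int => k - 1) @` [set` val Z])).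
  move=> j /=; rewrite bondE; case: ifP => [|+ _]; first by rewrite eqxx.
  rewrite /occupied; case: (boolP (j \in val Z)) => [jZ _|jZ]; first by left.
  by case: (boolP (j + 1 \in val Z)) => // jZ1 _; right; exists (j + 1);
    rewrite // addrK.
by rewrite finite_setU; split; [|apply: finite_image]; exact: finite_fset.
Qed.

Definition l2sq (psi : state) : \bar R :=
  \esum_(X in [set: config N]) (normc (psi X) ^+ 2)%:E.

Definition in_l2 (psi : state) : Prop := (l2sq psi < +oo)%E.

(* dPsi is the derivative at t, in the norm of l^2, of Psi *)
Definition is_l2_derive (Psi : R -> state) (t : R) (dPsi : state) : Prop :=
  in_l2 dPsi /\
  l2sq (fun X => (s^-1)%:C * (Psi (t + s) X - Psi t X) - dPsi X)
    @[s --> 0^'] --> 0%E.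

Definition schrodinger_solution (Y : config N) (Psi : R -> state) : Prop :=
  [/\ forall t, in_l2 (Psi t),
      forall t, exists2 dPsi : state, is_l2_derive Psi t dPsi &
        (fun X => 'i%C * dPsi X) = Hxxz (Psi t)
    & Psi 0 = basis_vec Y].

End Hamiltonian.

Section ContourIntegrals.
Variable R : realType.
Local Notation C := R[i].

Definition cexp (z : C) : C :=
  (expR (complex.Re z))%:C * (cos (complex.Im z) +i* sin (complex.Im z)).

Definition cintegral (a b : R) (f : R -> C) : C :=
  (\int[lebesgue_measure]_(u in `[a, b]) complex.Re (f u)) +i*
  (\int[lebesgue_measure]_(u in `[a, b]) complex.Im (f u)).

Definition circle (r theta : R) : C := r%:C * cexp ('i%C * theta%:C).

(* Integral over the positively oriented circle of radius r centered at 0,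
   including the factor 1/(2 pi i); the derivative of the parametrization
   [circle r] is 'i * circle r. *)
Definition circle_integral (r : R) (f : C -> C) : C :=
  (2 * pi%:C * 'i%C)^-1 *
  cintegral 0 (2 * pi) (fun theta =>
    f (circle r theta) * ('i%C * circle r theta)).

Definition fcons (n : nat) (z : C) (xi : 'I_n -> C) : 'I_n.+1 -> C :=
  fun i => if unlift ord0 i is Some k then xi k else z.

(* iterated integral over all the coordinates of xi : 'I_n -> C *)
Fixpoint multi_circle_integral (r : R) (n : nat) :
    (('I_n -> C) -> C) -> C :=
  match n with
  | 0 => fun F => F (fun=> 0)
  | n'.+1 => fun F => circle_integral r (fun z =>
      multi_circle_integral r (fun xi : 'I_n' -> C => F (fcons z xi)))
  end.

End ContourIntegrals.

Section BetheAnsatz.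
Variables (R : realType) (N : nat) (Delta : R).
Local Notation C := R[i].

Definition energy (z : C) : C := z + z^-1 - 2 * Delta%:C.

(* the factor S_{beta alpha}(zb, za) *)
Definition Sfactor (zb za : C) : C :=
  - ((1 + za * zb - 2 * Delta%:C * zb) / (1 + za * zb - 2 * Delta%:C * za)).

Definition inversion (s : 'S_N) (beta alpha : 'I_N) : bool :=
  (alpha < beta)%N && ((s^-1)%g beta < (s^-1)%g alpha)%N.

Definition Acoef (s : 'S_N) (xi : 'I_N -> C) : C :=
  \prod_(p : 'I_N * 'I_N | inversion s p.1 p.2) Sfactor (xi p.1) (xi p.2).

(* There are no S-factors, hence no condition, when N = 1. *)
Definition poles_inside (r : R) : Prop :=
  forall (alpha beta : 'I_N) (xi : 'I_N -> C), (alpha < beta)%N ->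
    r <= normc (xi alpha) -> r <= normc (xi beta) ->
    1 + xi alpha * xi beta - 2 * Delta%:C * xi alpha != 0.

Definition bethe_psi (r : R) (Y : config N) (t : R) (X : config N) : C :=
  \sum_(s : 'S_N) multi_circle_integral r (fun xi : 'I_N -> C =>
    Acoef s xi * (\prod_(i < N) xi (s i) ^ site X i) *
    \prod_(i < N) (xi i ^ (- site Y i - 1) *
                   cexp (- 'i%C * t%:C * energy (xi i)))).

End BetheAnsatz.

(* Main.v *)
Require Import Defs.
From mathcomp Require Import all_boot all_order all_fingroup all_algebra.
From mathcomp Require Import finmap complex.
From mathcomp Require Import all_classical all_reals all_analysis.
From mathcomp Require Import zify ring lra.
Set Implicit Arguments.
Unset Strict Implicit.
Unset Printing Implicit Defensive.
Import Order.TTheory GRing.Theory Num.Theory.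
Import numFieldTopology.Exports numFieldNormedType.Exports.
Local Open Scope classical_set_scope.
Local Open Scope complex_scope.
Local Open Scope ring_scope.

(** The Hamiltonian is a bounded operator H, so the solution starting from e_Y
    is exp(-itH) e_Y; the point is that the contour integrals compute it.

    Evolution. Inserting the total energy E(xi) = sum_i eps(xi_i) into the
    integrand amounts to applying H in the variable X.  Where the particles are
    not adjacent this is a shift of exponents ([bethe_function_out]); where two
    particles are adjacent the surplus terms cancel in pairs in the sum over
    permutations, because A_sigma f(xi_sigma(j), xi_sigma(i)) with
    f(a,b) = 1 + ab - 2 Delta a changes sign when the values of sigma at i and
    j = i+1 are exchanged ([Acoef_tperm_mul], [bethe_boundary_out]).  Expanding
    exp(-ihE) in the integrand therefore gives, pointwise,
    psi(t+h) = sum_k (-ih)^k/k! H^k psi(t) ([bethe_psi_expansion]).  As H is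
    bounded on l^1, starting from e_Y this controls psi(t) in l^1, and then the
    second order remainder in l^1, hence the derivative in l^2
    ([bethe_psi_derive]).

    Initial condition. Let phi(X,Y) be the formula at t = 0.  The condition on
    the poles forces 2|Delta|/r + 1/r^2 < 1 if N > 1 ([poles_inside_lt1]); hence
    on the torus |xi_i| = r every S-factor has a convergent expansion in the
    inverses of the xi_i ([laurent_limit_Sfactor]), and the integral reads off a
    coefficient.  So the term of sigma vanishes unless x_i >= y_sigma(i) for all i
    ([integral_term_eq0]).  If |X| denotes the sum of the sites of X and
    d = |X| - |Y|, this leaves only sigma = 1 when all the gaps between
    neighbouring sites of X exceed d, and nothing when d < 0, so that
    phi(X,Y) = delta_{X,Y} then.  To reach all X, note that phi also satisfies a
    boundary relation in Y, obtained by exchanging two integration variables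
    ([bethe_boundary_in]); hence phi commutes with H ([kernel_defect_commute]).
    Write the commutation relation at (X', Y), where X' is X with its m-th
    particle moved one step to the left: apart from phi(X,Y) itself, every term
    has a smaller d, or the same d and a larger m-th gap.  A double induction
    concludes ([kernel_defect_step], [kernel_defect0]).

    Uniqueness. A solution in l^2 is bounded on compact time intervals, uniformly
    in X ([l2_derive_bounded]).  The error r_n of its n-th Taylor polynomial
    satisfies r_{n+1}' = -i H r_n with r_{n+1}(0) = 0, so it is O((ct)^n/n!)
    ([taylor_bound]): every solution is the limit of the same polynomials
    sum_{k<n} (-it)^k/k! H^k e_Y.

    The integrals are handled through uniform limits of Laurent polynomials on
    the torus ([laurent_limit]).  They form an algebra closed under geometric
    series and exponentials, and on it the iterated integral is the continuous
    linear extension of the functional which takes the coefficient of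
    (xi_1 ... xi_n)^(-1) ([multi_integral_approx]); linearity, invariance under
    relabelling and vanishing are read off this description. *)

(** * The modulus of complex numbers *)

Section ComplexModulus.
Variable R : realType.
Implicit Types z w : R[i].

Lemma normc_ge0 z : 0 <= normc z.
Proof. by case: z => a b; exact: sqrtr_ge0. Qed.

Lemma normc_eq0 z : (normc z == 0) = (z == 0).
Proof.
by apply/eqP/eqP => [/ComplexField.Normc.eq0_normc //|->];
  exact: ComplexField.Normc.normc0.
Qed.

Lemma ler_normcD z w : normc (z + w) <= normc z + normc w.
Proof. exact: (le_normcD (R:=R)). Qed.

Lemma normc_opp z : normc (- z) = normc z.
Proof. exact: (normcN (R:=R)). Qed.

Lemma ler_normcB z w : normc (z - w) <= normc z + normc w.
Proof. by rewrite (le_trans (ler_normcD _ _)) // normc_opp. Qed.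

Lemma normc_real (x : R) : normc x%:C = `|x|.
Proof. by rewrite /= expr0n addr0 sqrtr_sqr. Qed.

Lemma normc_i : normc ('i%C : R[i]) = 1.
Proof. by rewrite /= expr0n add0r expr1n sqrtr1. Qed.

Lemma normc_sum (I : Type) (s : seq I) (P : pred I) (F : I -> R[i]) :
  normc (\sum_(i <- s | P i) F i) <= \sum_(i <- s | P i) normc (F i).
Proof.
elim/big_rec2: _ => [|i x y _ le_xy]; first by rewrite ComplexField.Normc.normc0.
by rewrite (le_trans (ler_normcD _ _)) // lerD2l.
Qed.

Lemma normc_prod (I : Type) (s : seq I) (P : pred I) (F : I -> R[i]) :
  normc (\prod_(i <- s | P i) F i) = \prod_(i <- s | P i) normc (F i).
Proof.
elim/big_rec2: _ => [|i x y _ h]; first by rewrite ComplexField.Normc.normc1.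
by rewrite ComplexField.Normc.normcM h.
Qed.

Lemma normcX z n : normc (z ^+ n) = normc z ^+ n.
Proof.
elim: n => [|n IHn]; first by rewrite !expr0 ComplexField.Normc.normc1.
by rewrite !exprS ComplexField.Normc.normcM IHn.
Qed.

Lemma normc_exprz z (m : int) : normc (z ^ m) = normc z ^ m.
Proof.
case: m => n; first exact: normcX.
by rewrite !NegzE -!exprnN ComplexField.Normc.normcV normcX.
Qed.

Lemma normc_Re z : `|complex.Re z| <= normc z.
Proof.
case: z => a b /=; rewrite -sqrtr_sqr ler_wsqrtr // lerDl; exact: sqr_ge0.
Qed.

Lemma normc_Im z : `|complex.Im z| <= normc z.
Proof.
case: z => a b /=; rewrite -sqrtr_sqr ler_wsqrtr // lerDr; exact: sqr_ge0.
Qed.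

Lemma normc_ReIm z : normc z <= `|complex.Re z| + `|complex.Im z|.
Proof.
rewrite [z in normc z]complexE (le_trans (ler_normcD _ _)) //.
by rewrite ComplexField.Normc.normcM normc_i mul1r !normc_real.
Qed.

(** Equalities between integrals are obtained by approximating both sides within
    every [e]. *)
Lemma normc_le_eps z (K : R) :
  (forall e, 0 < e -> normc z <= K * e) -> z = 0.
Proof.
move=> h; apply/eqP; rewrite -normc_eq0 eq_le normc_ge0 andbT.
have [K0|K0] := leP K 0.
  by rewrite (le_trans (h 1 ltr01)) // mulr1.
apply/ler_addgt0Pl => e e0; rewrite addr0.
by rewrite (le_trans (h (e / K) (divr_gt0 e0 K0))) // mulrCA divff ?mulr1 ?gt_eqF.
Qed.

Lemma ReD z w : complex.Re (z + w) = complex.Re z + complex.Re w.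
Proof. by case: z w => [a b] [c d]. Qed.
Lemma ImD z w : complex.Im (z + w) = complex.Im z + complex.Im w.
Proof. by case: z w => [a b] [c d]. Qed.
Lemma ReN z : complex.Re (- z) = - complex.Re z. Proof. by case: z. Qed.
Lemma ImN z : complex.Im (- z) = - complex.Im z. Proof. by case: z. Qed.
Lemma ReZ (a : R) z : complex.Re (a%:C * z) = a * complex.Re z.
Proof. by case: z => x y /=; rewrite mul0r subr0. Qed.
Lemma ImZ (a : R) z : complex.Im (a%:C * z) = a * complex.Im z.
Proof. by case: z => x y /=; rewrite mul0r addr0. Qed.

Lemma complexP z w :
  complex.Re z = complex.Re w -> complex.Im z = complex.Im w -> z = w.
Proof. by case: z w => [a b] [c d] /= -> ->. Qed.

End ComplexModulus.

(** * Taylor polynomials of linear differential equations *)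

Section Taylor.
Variable R : realType.
Local Notation C := R[i].

(** Differentiability is expressed on real and imaginary parts, so that the mean
    value theorem for real functions applies to each of them. *)
Definition cderiv (f : R -> C) (t : R) (l : C) : Prop :=
  is_derive t 1 (fun s => complex.Re (f s)) (complex.Re l) /\
  is_derive t 1 (fun s => complex.Im (f s)) (complex.Im l).

Lemma cderiv_eq f t l l' : cderiv f t l -> l = l' -> cderiv f t l'.
Proof. by move=> + <-. Qed.

Lemma cderivD f g t l m :
  cderiv f t l -> cderiv g t m -> cderiv (fun s => f s + g s) t (l + m).
Proof.
move=> [h1 h2] [k1 k2]; split.
  rewrite ReD; rewrite (_ : (fun s => _) =
    (fun s => complex.Re (f s)) \+ (fun s => complex.Re (g s))).
    exact: is_deriveD.
  by apply/funext => s; rewrite /= ReD.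
rewrite ImD; rewrite (_ : (fun s => _) =
  (fun s => complex.Im (f s)) \+ (fun s => complex.Im (g s))).
  exact: is_deriveD.
by apply/funext => s; rewrite /= ImD.
Qed.

Lemma cderiv_realM (a : R -> R) (a' : R) (z : C) (t : R) :
  is_derive t 1 a a' -> cderiv (fun s => (a s)%:C * z) t (a'%:C * z).
Proof.
move=> h; split.
  rewrite ReZ mulrC (_ : (fun s => _) = complex.Re z \*: a).
    exact: is_deriveZ.
  by apply/funext => s; rewrite ReZ mulrC.
rewrite ImZ mulrC (_ : (fun s => _) = complex.Im z \*: a).
  exact: is_deriveZ.
by apply/funext => s; rewrite ImZ mulrC.
Qed.

Definition divided_power (k : nat) (t : R) : R := t ^+ k / k`!%:R.

Lemma divided_power0 t : divided_power 0 t = 1.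
Proof. by rewrite /divided_power expr0 fact0 divr1. Qed.

Lemma divided_powerS0 k : divided_power k.+1 0 = 0.
Proof. by rewrite /divided_power expr0n mul0r. Qed.

Lemma divided_power_ge0 k t : 0 <= t -> 0 <= divided_power k t.
Proof. by move=> t0; rewrite divr_ge0 ?exprn_ge0. Qed.

Lemma is_derive_divided_power k (t : R) :
  is_derive t 1 (divided_power k.+1) (divided_power k t).
Proof.
rewrite (_ : divided_power k.+1 = (k.+1`!%:R^-1) \*: (fun s : R => s ^+ k.+1)); last first.
  by apply/funext => s; rewrite /divided_power mulrC.
rewrite (_ : divided_power k t = k.+1`!%:R^-1 *: ((k.+1%:R * t ^+ k) *: (1:R))).
  apply: is_deriveZ; rewrite (_ : (fun s => _) = (@id R) ^+ k.+1).
    exact: is_deriveX.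
  by apply/funext => s; rewrite exprfctE.
rewrite /GRing.scale /= mulr1 factS natrM invfM /divided_power.
have h1 : k.+1%:R != 0 :> R by rewrite pnatr_eq0.
have h2 : k`!%:R != 0 :> R by rewrite pnatr_eq0 -lt0n fact_gt0.
by field; rewrite h2 nat1r h1.
Qed.

(** By the mean value theorem applied to [K t^(n+1)/(n+1)! - e phi] for [e = 1]
    and [e = -1], a function whose derivative is nonnegative between 0
    and [T]. *)
Lemma le_divided_power (phi phi' : R -> R) (K T : R) n :
  (forall t : R, is_derive t 1 phi (phi' t)) -> phi 0 = 0 ->
  (forall t : R, 0 <= t <= T -> `|phi' t| <= K * divided_power n t) ->
  forall t : R, 0 <= t <= T -> `|phi t| <= K * divided_power n.+1 t.
Proof.
move=> dphi phi0 hb t /andP[t0 tT].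
have [->|tn0] := eqVneq t 0; first by rewrite phi0 normr0 divided_powerS0 mulr0.
have tp : 0 < t by rewrite lt_neqAle eq_sym tn0.
have main (e : R) : `|e| = 1 -> e * phi t <= K * divided_power n.+1 t.
  move=> e1; pose g := (K \*: divided_power n.+1) \+ ((- e) \*: phi).
  have dg (s : R) : is_derive s 1 g (K *: divided_power n s + (- e) *: phi' s).
    by apply: is_deriveD; apply: is_deriveZ => //; exact: is_derive_divided_power.
  have cg : {within `[0, t], continuous g}.
    apply: continuous_subspaceT => x.
    by apply/differentiable_continuous/derivable1_diffP; case: (dg x).
  (* the increment g t - g 0 has the sign of g' *)
  have [x xt] := MVT tp (fun x _ => dg x) cg.
  rewrite /g /= /GRing.scale /= divided_powerS0 phi0 !mulr0 addr0 !subr0 mulNr => gE.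
  rewrite -subr_ge0 gE mulr_ge0 // mulNr subr_ge0.
  move: xt; rewrite in_itv /= => /andP[x0 xt].
  rewrite (le_trans (ler_norm _)) // normrM e1 mul1r hb //.
  by rewrite (ltW x0) (le_trans (ltW xt)).
rewrite ler_norml; apply/andP; split.
  by rewrite lerNl -mulN1r main // normrN1.
by rewrite -[phi t]mul1r main // normr1.
Qed.

Section ODE.
Variables (J : Type) (H : (J -> C) -> J -> C) (c : R).
Hypothesis operator_linear : forall (a : C) u v,
  H (fun X => a * u X + v X) = fun X => a * H u X + H v X.
Hypothesis operator_bound : forall v M, (forall X, normc (v X) <= M) ->
  forall X, normc (H v X) <= c * M.

Definition taylor (kappa : C) (v : J -> C) n (t : R) : J -> C := fun X =>
  \sum_(k < n) (divided_power k t)%:C * (kappa ^+ k * iter k H v X).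

Lemma operator0 : H (fun=> 0) = fun=> 0.
Proof.
have := operator_linear (-1) (fun=> 0) (fun=> 0).
by under eq_fun do rewrite mulr0 addr0; move=> {1}->; apply/funext => X; rewrite mulN1r addNr.
Qed.

Lemma operator_sum (I : Type) (s : seq I) (a : I -> C) (u : I -> J -> C) :
  H (fun X => \sum_(i <- s) a i * u i X) = fun X => \sum_(i <- s) a i * H (u i) X.
Proof.
elim: s => [|i s IHs].
  under eq_fun do rewrite big_nil.
  by rewrite operator0; apply/funext => X; rewrite big_nil.
under eq_fun do rewrite big_cons.
by rewrite operator_linear IHs; apply/funext => X; rewrite big_cons.
Qed.

Lemma operator_taylor kappa v n t :
  H (taylor kappa v n t) = fun X =>
  \sum_(k < n) (divided_power k t)%:C * (kappa ^+ k * iter k.+1 H v X).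
Proof.
rewrite (_ : taylor kappa v n t = fun X =>
  \sum_(k < n) ((divided_power k t)%:C * kappa ^+ k) * iter k H v X).
  by rewrite operator_sum; apply/funext => X; apply: eq_bigr => k _; rewrite mulrA.
by apply/funext => X; apply: eq_bigr => k _; rewrite mulrA.
Qed.

(** The error of the Taylor polynomial of order [n.+1] vanishes at 0 and has
    derivative [kappa * H] applied to the error of order [n]; the bound follows
    by induction on [n] with [le_divided_power].  The factor 2 accounts for
    treating real and imaginary parts separately. *)
Lemma taylor_bound (kappa : C) (Psi : R -> J -> C) (T M : R) :
  normc kappa <= 1 ->
  (forall t X, cderiv (Psi ^~ X) t (kappa * H (Psi t) X)) ->
  (forall t X, 0 <= t <= T -> normc (Psi t X) <= M) ->
  forall n t X, 0 <= t <= T ->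
    normc (Psi t X - taylor kappa (Psi 0) n t X) <= M * (2 * c) ^+ n * divided_power n t.
Proof.
move=> k1 dPsi bPsi; elim=> [|n IHn] t X tT.
  by rewrite /taylor big_ord0 subr0 expr0 divided_power0 !mulr1 bPsi.
pose res m s Z := Psi s Z - taylor kappa (Psi 0) m s Z.
have resE m s : res m s = fun Z => (-1) * taylor kappa (Psi 0) m s Z + Psi s Z.
  by apply/funext => Z; rewrite /res mulN1r addrC.
have dres s : cderiv (fun u => res n.+1 u X) s (kappa * H (res n s) X).
  have dt : cderiv (fun u => taylor kappa (Psi 0) n.+1 u X) s
              (kappa * H (taylor kappa (Psi 0) n s) X).
    rewrite /taylor.
    under eq_fun do rewrite big_ord_recl /=.
    apply: (cderiv_eq (l := 0%:C * (kappa ^+ 0 * Psi 0 X) +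
       \sum_(k < n) (divided_power k s)%:C * (kappa ^+ k.+1 * iter k.+1 H (Psi 0) X))).
      apply: cderivD.
        apply: cderiv_realM; rewrite (_ : divided_power 0 = cst 1).
          exact: is_derive_cst.
        by apply/funext => u; rewrite divided_power0.
      elim: n {IHn} => [|m IHm].
        under eq_fun do rewrite big_ord0.
        by rewrite big_ord0; split; exact: is_derive_cst.
      under eq_fun do rewrite big_ord_recr /=.
      rewrite big_ord_recr; apply: cderivD => //.
      by apply: cderiv_realM; exact: is_derive_divided_power.
    rewrite mul0r add0r operator_taylor mulr_sumr; apply: eq_bigr => k _.
    by rewrite exprS; ring.
  apply: (cderiv_eq (l := kappa * H (Psi s) X + (-1)%:C * (kappa * H (taylor kappa (Psi 0) n s) X))).
    rewrite /res; apply: cderivD => //.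
    case: dt => dt1 dt2; split.
      rewrite ReZ mulN1r; under eq_fun do rewrite ReN; exact: is_deriveN.
    rewrite ImZ mulN1r; under eq_fun do rewrite ImN; exact: is_deriveN.
  rewrite resE operator_linear rmorphN1; ring.
have res0 : res n.+1 0 X = 0.
  rewrite /res /taylor big_ord_recl big1 ?addr0.
    by rewrite divided_power0 expr0 !mul1r subrr.
  by move=> i _; rewrite divided_powerS0 mul0r.
have nb s : 0 <= s <= T ->
    normc (kappa * H (res n s) X) <= c * (M * (2 * c) ^+ n) * divided_power n s.
  move=> sT; rewrite ComplexField.Normc.normcM.
  apply: (@le_trans _ _ (1 * (c * (M * (2 * c) ^+ n * divided_power n s)))); last by rewrite mul1r !mulrA.
  apply: ler_pM; rewrite ?normc_ge0 //.
  by apply: operator_bound => Z; apply: IHn.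
apply: (le_trans (normc_ReIm _)).
rewrite (_ : _ * _ = c * (M * (2 * c) ^+ n) * divided_power n.+1 t +
                     c * (M * (2 * c) ^+ n) * divided_power n.+1 t); last by rewrite exprS; ring.
apply: lerD.
- apply: (le_divided_power (phi := fun s => complex.Re (res n.+1 s X)) (fun s => (dres s).1)) tT.
    by rewrite res0.
  by move=> s sT; rewrite (le_trans (normc_Re _)) ?nb.
- apply: (le_divided_power (phi := fun s => complex.Im (res n.+1 s X)) (fun s => (dres s).2)) tT.
    by rewrite res0.
  by move=> s sT; rewrite (le_trans (normc_Im _)) ?nb.
Qed.

End ODE.

End Taylor.

(** * The complex exponential *)

Section Exponential.
Variable R : realType.
Implicit Types z w : R[i].

Lemma cexp0 : cexp (0 : R[i]) = 1.
Proof. by rewrite /cexp /= expR0 cos0 sin0 mul1r. Qed.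

Lemma cexpD z w : cexp (z + w) = cexp z * cexp w.
Proof.
rewrite /cexp ReD ImD expRD cosD sinD.
by apply: complexP => /=; ring.
Qed.

Lemma cexp_sum (I : Type) (s : seq I) (F : I -> R[i]) :
  cexp (\sum_(i <- s) F i) = \prod_(i <- s) cexp (F i).
Proof.
elim: s => [|i s IHs]; first by rewrite !big_nil cexp0.
by rewrite !big_cons cexpD IHs.
Qed.

Lemma normc_cexp z : normc (cexp z) = expR (complex.Re z).
Proof.
rewrite /cexp ComplexField.Normc.normcM normc_real /= cos2Dsin2 sqrtr1 mulr1.
by rewrite ger0_norm ?expR_ge0.
Qed.

Lemma cderiv_cexp z (t : R) :
  cderiv (fun s => cexp (s%:C * z)) t (z * cexp (t%:C * z)).
Proof.
case: z => a b.
have dl (u : R) : is_derive t 1 (fun s => s * u) u.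
  rewrite (_ : (fun s => _) = u \*: (@id R)).
    by apply: is_derive_eq; rewrite /GRing.scale /= mulr1.
  by apply/funext => s; rewrite /GRing.scale /= mulrC.
have de : is_derive t 1 (expR \o (fun s => s * a)) (expR (t * a) * a).
  exact: is_derive1_comp.
have dc : is_derive t 1 (cos \o (fun s => s * b)) (- sin (t * b) * b).
  exact: is_derive1_comp.
have ds : is_derive t 1 (sin \o (fun s => s * b)) (cos (t * b) * b).
  exact: is_derive1_comp.
split.
  rewrite (_ : (fun s => _) = (expR \o (fun s => s * a)) * (cos \o (fun s => s * b))).
    apply: is_derive_eq; rewrite /GRing.scale /= !mul0r !subr0 ?addr0; ring.
  by apply/funext => s; rewrite /cexp ReZ ImZ /= mul0r subr0.
rewrite (_ : (fun s => _) = (expR \o (fun s => s * a)) * (sin \o (fun s => s * b))).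
  apply: is_derive_eq; rewrite /GRing.scale /= !mul0r !subr0 ?addr0; ring.
by apply/funext => s; rewrite /cexp ReZ ImZ /= mul0r addr0.
Qed.

Definition exp_partial n z : R[i] := \sum_(k < n) (k`!%:R^-1)%:C * z ^+ k.

(** [s |-> exp(sz)] solves the scalar equation [u' = z u], and for [s] between 0
    and 1 it is bounded by [exp |z|]: an instance of [taylor_bound]. *)
Lemma cexp_taylor n z :
  normc (cexp z - exp_partial n z) <= expR (normc z) * divided_power n (2 * normc z).
Proof.
pose H (v : unit -> R[i]) := fun X => z * v X.
have Hl a u v : H (fun X => a * u X + v X) = fun X => a * H u X + H v X.
  by apply/funext => X; rewrite /H; ring.
have Hb v M : (forall X, normc (v X) <= M) -> forall X, normc (H v X) <= normc z * M.
  by move=> h X; rewrite ComplexField.Normc.normcM ler_wpM2l ?normc_ge0.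
pose Psi (s : R) (_ : unit) := cexp (s%:C * z).
have dPsi t X : cderiv (Psi ^~ X) t (1 * H (Psi t) X).
  by rewrite mul1r; exact: cderiv_cexp.
have bPsi t X : 0 <= t <= 1 -> normc (Psi t X) <= expR (normc z).
  move=> /andP[t0 t1]; rewrite normc_cexp ler_expR ReZ.
  rewrite (le_trans (ler_norm _)) // normrM ger0_norm //.
  by rewrite -[leRHS]mul1r ler_pM ?normr_ge0 ?normc_Re.
have n1 : normc (1 : R[i]) <= 1 by rewrite ComplexField.Normc.normc1.
have t1 : 0 <= (1 : R) <= 1 by rewrite ler01 lexx.
have := taylor_bound Hl Hb n1 dPsi bPsi n tt t1.
rewrite {1}/Psi mul1r (_ : taylor _ _ _ _ _ _ = exp_partial n z).
  by move=> /le_trans; apply; rewrite /divided_power expr1n mul1r mulrA lexx.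
rewrite /taylor /exp_partial; apply: eq_bigr => k _; rewrite expr1n mul1r /divided_power expr1n mul1r; congr (_ * _).
elim: (nat_of_ord k) => [|m IHm]; first by rewrite /= /Psi rmorph0 mul0r cexp0 expr0.
by rewrite iterS /H IHm exprS.
Qed.

Lemma divided_power_cvg0 (x e : R) : 0 < e ->
  exists n, forall m, (n <= m)%N -> `|divided_power m x| <= e.
Proof.
move=> e0; have := cvg_series_cvg_0 (is_cvg_series_exp_coeff x).
move/cvgr0Pnorm_le => /(_ _ e0) [n _ hn]; exists n => m nm.
exact: hn.
Qed.

Lemma sum_divided_power_le (x : R) n : 0 <= x ->
  \sum_(k < n) divided_power k x <= expR x.
Proof.
move=> x0.
have -> : \sum_(k < n) divided_power k x = series (exp_coeff x) n.
  by rewrite seriesEord.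
apply: nondecreasing_cvgn_le; last exact: is_cvg_series_exp_coeff.
by apply: nondecreasing_series => k _ _; exact: divided_power_ge0.
Qed.

End Exponential.

(** * Integrals over one circle *)

Section CircleIntegral.
Variable R : realType.
Local Notation C := R[i].
Local Notation mu := (@lebesgue_measure R).

Definition ccontinuous (h : R -> C) : Prop :=
  continuous (fun u => complex.Re (h u)) /\ continuous (fun u => complex.Im (h u)).

Lemma ccontinuousD h k :
  ccontinuous h -> ccontinuous k -> ccontinuous (fun u => h u + k u).
Proof.
move=> [h1 h2] [k1 k2]; split => u.
  by under eq_fun do rewrite ReD; exact: (cvgD (h1 u) (k1 u)).
by under eq_fun do rewrite ImD; exact: (cvgD (h2 u) (k2 u)).
Qed.

Lemma ccontinuousM h k :
  ccontinuous h -> ccontinuous k -> ccontinuous (fun u => h u * k u).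
Proof.
move=> [h1 h2] [k1 k2].
have ReM (z w : C) : complex.Re (z * w) =
    complex.Re z * complex.Re w - complex.Im z * complex.Im w.
  by case: z w => [a b] [c d].
have ImM (z w : C) : complex.Im (z * w) =
    complex.Re z * complex.Im w + complex.Im z * complex.Re w.
  by case: z w => [a b] [c d].
split => u.
  under eq_fun do rewrite ReM.
  exact: (cvgB (cvgM (h1 u) (k1 u)) (cvgM (h2 u) (k2 u))).
under eq_fun do rewrite ImM.
exact: (cvgD (cvgM (h1 u) (k2 u)) (cvgM (h2 u) (k1 u))).
Qed.

Lemma ccontinuous_cst z : ccontinuous (fun=> z).
Proof. by split => u; exact: cvg_cst. Qed.

Lemma ccontinuous_sum (I : Type) (s : seq I) (F : I -> R -> C) :
  (forall i, ccontinuous (F i)) -> ccontinuous (fun u => \sum_(i <- s) F i u).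
Proof.
move=> hF; elim: s => [|i s IHs].
  by under eq_fun do rewrite big_nil; exact: ccontinuous_cst.
by under eq_fun do rewrite big_cons; exact: ccontinuousD.
Qed.

(** A uniform limit of continuous functions is continuous, whence integrable on a
    segment: this gives a meaning to the integrals of the approximated
    functions. *)
Lemma ccontinuous_uniform h :
  (forall e, 0 < e -> exists2 k, ccontinuous k & forall u, normc (h u - k u) <= e) ->
  ccontinuous h.
Proof.
move=> happ.
have main (p : C -> R) : (forall z w, p (z - w) = p z - p w) ->
    (forall z, `|p z| <= normc z) ->
    (forall k, ccontinuous k -> continuous (fun u => p (k u))) ->
    continuous (fun u => p (h u)).
  move=> pB ple pc u; apply/cvgrPdist_le => e e0.
  have e3 : 0 < e / 3 by rewrite divr_gt0.
  have [k ck hk] := happ _ e3.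
  have /cvgrPdist_le/(_ _ e3) := pc k ck u.
  apply: filterS => v kv.
  have -> : p (h u) - p (h v) = (p (h u - k u) + (p (k u) - p (k v))) - p (h v - k v).
    by rewrite !pB; ring.
  rewrite (le_trans (ler_normB _ _)) // (_ : e = e / 3 + e / 3 + e / 3); last by field.
  rewrite lerD ?(le_trans (ple _)) // (le_trans (ler_normD _ _)) // lerD //.
  by rewrite (le_trans (ple _)).
split.
  apply: (main (@complex.Re R)) => [z w|z|k []//].
    by rewrite ReD ReN.
  exact: normc_Re.
apply: (main (@complex.Im R)) => [z w|z|k []//].
  by rewrite ImD ImN.
exact: normc_Im.
Qed.

Lemma continuous_segment_integrable (a b : R) (f : R -> R) :
  continuous f -> mu.-integrable `[a, b] (EFin \o f).
Proof.
move=> cf; apply: continuous_compact_integrable; first exact: segment_compact.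
exact: continuous_subspaceT.
Qed.

Lemma continuous_scale (a : R) (f : R -> R) : continuous f -> continuous (fun u => a * f u).
Proof. by move=> cf u; exact: (cvgM (cvg_cst a) (cf u)). Qed.

Lemma cintegralD (a b : R) h k : ccontinuous h -> ccontinuous k ->
  cintegral a b (fun u => h u + k u) = cintegral a b h + cintegral a b k.
Proof.
move=> [h1 h2] [k1 k2]; rewrite /cintegral; apply: complexP => /=.
  under eq_Rintegral do rewrite ReD.
  by apply: RintegralD => //; exact: continuous_segment_integrable.
under eq_Rintegral do rewrite ImD.
by apply: RintegralD => //; exact: continuous_segment_integrable.
Qed.

Lemma cintegralZ (a b : R) (z : C) h : ccontinuous h ->
  cintegral a b (fun u => z * h u) = z * cintegral a b h.
Proof.
move=> [h1 h2]; case: z => x y.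
have ReM u : complex.Re ((x +i* y) * h u) = x * complex.Re (h u) - y * complex.Im (h u).
  by case: (h u).
have ImM u : complex.Im ((x +i* y) * h u) = x * complex.Im (h u) + y * complex.Re (h u).
  by case: (h u).
apply: complexP.
  rewrite -[LHS]/(\int[mu]_(u in `[a, b]) complex.Re ((x +i* y) * h u)).
  under eq_Rintegral do rewrite ReM.
  rewrite RintegralB //.
  - by rewrite !RintegralZl //; exact: continuous_segment_integrable.
  - exact/continuous_segment_integrable/continuous_scale.
  - exact/continuous_segment_integrable/continuous_scale.
rewrite -[LHS]/(\int[mu]_(u in `[a, b]) complex.Im ((x +i* y) * h u)).
under eq_Rintegral do rewrite ImM.
rewrite RintegralD //.
- by rewrite !RintegralZl //; exact: continuous_segment_integrable.
- exact/continuous_segment_integrable/continuous_scale.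
- exact/continuous_segment_integrable/continuous_scale.
Qed.

Lemma cintegral_sum (a b : R) (I : Type) (s : seq I) (F : I -> R -> C) :
  (forall i, ccontinuous (F i)) ->
  cintegral a b (fun u => \sum_(i <- s) F i u) = \sum_(i <- s) cintegral a b (F i).
Proof.
move=> hF; elim: s => [|i s IHs].
  under eq_fun do rewrite big_nil.
  have := cintegralZ a b 0 (ccontinuous_cst 0).
  by under eq_fun do rewrite mul0r; rewrite big_nil mul0r.
under eq_fun do rewrite big_cons.
by rewrite cintegralD ?big_cons ?IHs //; exact: ccontinuous_sum.
Qed.

Lemma normc_cintegral (a b B : R) h : a < b -> ccontinuous h ->
  (forall u, normc (h u) <= B) -> normc (cintegral a b h) <= 2 * (b - a) * B.
Proof.
move=> ab [h1 h2] hB.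
have main (f : R -> R) : continuous f -> (forall u, `|f u| <= B) ->
    `| \int[mu]_(u in `[a, b]) f u | <= (b - a) * B.
  move=> cf fB; apply: le_trans (le_normr_Rintegral _ _) _ => //.
    exact: continuous_segment_integrable.
  have -> : (b - a) * B = \int[mu]_(u in `[a, b]) (cst B u).
    by rewrite Rintegral_cst //= lebesgue_measure_itv /= lte_fin ab /= mulrC.
  apply: le_Rintegral => //.
  - apply: continuous_segment_integrable => u; exact: (cvg_norm (cf u)).
  - by apply: continuous_segment_integrable => u; exact: cvg_cst.
apply: (le_trans (normc_ReIm _)); rewrite -mulrA mulr_natl mulr2n lerD //.
  by apply: main => // u; rewrite (le_trans (normc_Re _)).
by apply: main => // u; rewrite (le_trans (normc_Im _)).
Qed.

Definition cis (x : R) : C := cos x +i* sin x.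

Lemma cisD x y : cis (x + y) = cis x * cis y.
Proof. by rewrite /cis cosD sinD; apply: complexP => //=; ring. Qed.

Lemma cis0 : cis 0 = 1. Proof. by rewrite /cis cos0 sin0. Qed.

Lemma cis2pi : cis (2 * pi) = 1.
Proof. by rewrite /cis mulr_natl cos2pi sin2pi. Qed.

Lemma cis_exprz x (m : int) : cis x ^ m = cis (m%:~R * x).
Proof.
have hn (n : nat) : cis x ^+ n = cis (n%:R * x).
  elim: n => [|n IHn]; first by rewrite mul0r cis0.
  by rewrite exprS IHn -cisD -[n.+1%:R]nat1r mulrDl mul1r.
case: m => n; first exact: hn.
rewrite NegzE -exprnN hn mulrNz mulNr.
have h : cis (n.+1%:R * x) * cis (- (n.+1%:R * x)) = 1 by rewrite -cisD subrr cis0.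
have h0 : cis (n.+1%:R * x) != 0.
  by apply/eqP => h1; move/eqP: h; rewrite h1 mul0r eq_sym oner_eq0.
by apply: (mulfI h0); rewrite h mulfV.
Qed.

Lemma circleE (r x : R) : circle r x = r%:C * cis x.
Proof.
rewrite /circle (_ : 'i%C * x%:C = 0 +i* x); first by rewrite /cexp /= expR0 mul1r.
by apply: complexP => /=; ring.
Qed.

Lemma normc_circle (r x : R) : 0 < r -> normc (circle r x) = r.
Proof.
move=> r0; rewrite circleE ComplexField.Normc.normcM normc_real gtr0_norm //.
by rewrite /= cos2Dsin2 sqrtr1 mulr1.
Qed.

Lemma circleX (r x : R) (m : int) : circle r x ^ m = (r ^ m)%:C * cis (m%:~R * x).
Proof.
rewrite circleE expfzMl cis_exprz; congr (_ * _).
by case: m => n; rewrite ?NegzE -?exprnN ?fmorphV rmorphXn.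
Qed.

Lemma ccontinuous_cis (c : R) : ccontinuous (fun x => cis (c * x)).
Proof.
have hc : continuous (fun x : R => c * x) by apply: continuous_scale => u; exact: cvg_id.
split => u /=.
  apply: (continuous_comp (f := fun x : R => c * x) (g := cos)); first exact: hc.
  exact: continuous_cos.
apply: (continuous_comp (f := fun x : R => c * x) (g := sin)); first exact: hc.
exact: continuous_sin.
Qed.

Lemma cintegral_cis (m : int) : m != 0 -> cintegral 0 (2 * pi) (fun x => cis (m%:~R * x)) = 0.
Proof.
move=> m0; have mR0 : m%:~R != 0 :> R by rewrite intr_eq0.
have p0 : (0 : R) < 2 * pi by rewrite mulr_gt0 ?pi_gt0.
have [c1 c2] := ccontinuous_cis m%:~R.
have dl (u : R) : is_derive u 1 (fun s : R => m%:~R * s) (m%:~R : R).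
  rewrite (_ : (fun s => _) = m%:~R \*: (@id R)) //.
  by apply: is_derive_eq; rewrite /GRing.scale /= mulr1.
have ftc (f F : R -> R) : continuous f -> (forall x : R, is_derive x 1 F (f x)) ->
    F (2 * pi) = F 0 -> \int[mu]_(x in `[0, 2 * pi]) f x = 0.
  move=> cf dF eF; rewrite /Rintegral (continuous_FTC2 (F := F) p0).
  - by rewrite eF subee.
  - exact: continuous_subspaceT.
  - have cF : continuous F.
      by move=> x; apply/differentiable_continuous/derivable1_diffP; case: (dF x).
    split => [x _||]; first by case: (dF x).
      exact/cvg_at_right_filter/cF.
    exact/cvg_at_left_filter/cF.
  - by move=> x _; rewrite derive1E; case: (dF x).
have cis_end : cis (m%:~R * (2 * pi)) = 1 by rewrite -cis_exprz cis2pi exp1rz.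
rewrite /cintegral /=; apply: complexP => /=.
  apply: (ftc _ (m%:~R^-1 \*: (sin \o (fun s : R => m%:~R * s)))) => //.
    move=> x.
    have d : is_derive x 1 (sin \o (fun s : R => m%:~R * s)) (cos (m%:~R * x) * m%:~R).
      exact: is_derive1_comp.
    apply: is_derive_eq (is_deriveZ _ d) _.
    by rewrite /GRing.scale /= mulrC mulfK.
  by case: cis_end => _; rewrite /GRing.scale /= => ->; rewrite mulr0 sin0.
apply: (ftc _ ((- m%:~R^-1) \*: (cos \o (fun s : R => m%:~R * s)))) => //.
  move=> x.
  have d : is_derive x 1 (cos \o (fun s : R => m%:~R * s)) (- sin (m%:~R * x) * m%:~R).
    exact: is_derive1_comp.
  apply: is_derive_eq (is_deriveZ _ d) _.
  by rewrite /GRing.scale /=; field.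
by case: cis_end; rewrite /GRing.scale /= => -> _; rewrite mulr0 cos0.
Qed.

Definition laurent1 (q : seq (C * int)) (z : C) : C := \sum_(a <- q) a.1 * z ^ a.2.
Definition residue1 (q : seq (C * int)) : C := \sum_(a <- q | a.2 == -1) a.1.

Lemma ccontinuous_circleX (r : R) (m : int) : ccontinuous (fun x => circle r x ^ m).
Proof.
have -> : (fun x => circle r x ^ m) = (fun x => (r ^ m)%:C * cis (m%:~R * x)).
  by apply/funext => x; exact: circleX.
by apply: ccontinuousM; [exact: ccontinuous_cst|exact: ccontinuous_cis].
Qed.

Lemma circle_integral_X (r : R) (m : int) : 0 < r ->
  cintegral 0 (2 * pi) (fun x => circle r x ^ m * ('i%C * circle r x)) =
  (2 * pi%:C * 'i%C) * (m == -1)%:R.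
Proof.
move=> r0.
have p0 : (0 : R) < 2 * pi by rewrite mulr_gt0 ?pi_gt0.
have cn0 x : circle r x != 0 by rewrite -normc_eq0 normc_circle // gt_eqF.
have -> : (fun x => circle r x ^ m * ('i%C * circle r x)) =
    (fun x => ('i%C * (r ^ (m + 1))%:C) * cis ((m + 1)%:~R * x)).
  apply/funext => x; rewrite mulrCA -[X in _ * (_ * X)]expr1z -expfzDr //.
  by rewrite circleX mulrA.
rewrite cintegralZ; last exact: ccontinuous_cis.
have [->|m1] := eqVneq m (-1).
  have -> : cintegral 0 (2 * pi) (fun x => cis ((-1 + 1)%:~R * x)) = (2 * pi)%:C.
    under eq_fun do rewrite mul0r cis0.
    rewrite /cintegral /=; apply: complexP => /=.
      by rewrite Rintegral_cst //= lebesgue_measure_itv /= lte_fin p0 /= mul1r subr0.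
    by rewrite Rintegral_cst //= mul0r.
  by rewrite addNr expr0z mulr1 rmorphM /= rmorph_nat mulr1 mulrC.
by rewrite cintegral_cis ?mulr0 // addr_eq0.
Qed.

Lemma circle_integral_laurent (r : R) q : 0 < r ->
  circle_integral r (laurent1 q) = residue1 q.
Proof.
move=> r0; rewrite /circle_integral /laurent1.
have p0 : (pi%:C : C) != 0.
  by rewrite -normc_eq0 normc_real normr_eq0 gt_eqF ?pi_gt0.
have i0 : ('i%C : C) != 0 by rewrite -normc_eq0 normc_i oner_eq0.
have -> : (fun x => (\sum_(a <- q) a.1 * circle r x ^ a.2) * ('i%C * circle r x)) =
    (fun x => \sum_(a <- q) a.1 * (circle r x ^ a.2 * ('i%C * circle r x))).
  by apply/funext => x; rewrite mulr_suml; apply: eq_bigr => a _; rewrite -mulrA.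
have cc m : ccontinuous (fun x => circle r x ^ m * ('i%C * circle r x)).
  apply: ccontinuousM; first exact: ccontinuous_circleX.
  apply: ccontinuousM; first exact: ccontinuous_cst.
  exact: (ccontinuous_circleX r 1).
rewrite cintegral_sum; last first.
  by move=> a; apply: ccontinuousM => //; exact: ccontinuous_cst.
rewrite mulr_sumr /residue1 [RHS]big_mkcond; apply: eq_bigr => a _.
rewrite cintegralZ // circle_integral_X //.
case: eqP => _; last by rewrite !mulr0.
by rewrite mulr1 mulrCA mulVf ?mulr1 // !mulf_neq0 // pnatr_eq0.
Qed.

(** The integral of a uniform limit of Laurent polynomials is within [2 r e] of
    the residue of any approximation within [e]; the 2 comes again from the real
    and imaginary parts. *)
Lemma circle_integral_approx (r : R) (g : C -> C) : 0 < r ->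
  (forall e, 0 < e -> exists q, forall z, normc z = r -> normc (g z - laurent1 q z) <= e) ->
  forall q e, (forall z, normc z = r -> normc (g z - laurent1 q z) <= e) ->
  normc (circle_integral r g - residue1 q) <= 2 * r * e.
Proof.
move=> r0 happ q e hq; rewrite -(circle_integral_laurent q r0) /circle_integral -mulrBr.
have p0 : (0 : R) < 2 * pi by rewrite mulr_gt0 ?pi_gt0.
have cq p : ccontinuous (fun x => laurent1 p (circle r x) * ('i%C * circle r x)).
  apply: ccontinuousM.
    apply: ccontinuous_sum => a; apply: ccontinuousM; first exact: ccontinuous_cst.
    exact: ccontinuous_circleX.
  apply: ccontinuousM; first exact: ccontinuous_cst.
  exact: (ccontinuous_circleX r 1).
have nic x : normc ('i%C * circle r x) = r.
  by rewrite ComplexField.Normc.normcM normc_i mul1r normc_circle.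
have cg : ccontinuous (fun x => g (circle r x) * ('i%C * circle r x)).
  apply: ccontinuous_uniform => d d0.
  have [p hp] := happ _ (divr_gt0 d0 r0).
  exists (fun x => laurent1 p (circle r x) * ('i%C * circle r x)) => // x.
  rewrite -mulrBl ComplexField.Normc.normcM nic -ler_pdivlMr //.
  by apply: hp; exact: normc_circle.
rewrite -mulN1r -cintegralZ // -cintegralD //; last first.
  by apply: ccontinuousM => //; exact: ccontinuous_cst.
rewrite ComplexField.Normc.normcM ComplexField.Normc.normcV.
rewrite !ComplexField.Normc.normcM normc_i mulr1 normc_real.
rewrite (_ : normc 2 = 2); last by rewrite -(rmorph_nat (real_complex R)) normc_real normr_nat.
rewrite (gtr0_norm (pi_gt0 R)) mulrC ler_pdivrMr //.
apply: le_trans (normc_cintegral (B := r * e) p0 _ _) _.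
- by apply: ccontinuousD => //; apply: ccontinuousM => //; exact: ccontinuous_cst.
- move=> x; rewrite mulN1r -mulrBl ComplexField.Normc.normcM nic mulrC.
  by rewrite ler_wpM2l ?(ltW r0) // hq // normc_circle.
by rewrite subr0 le_eqVlt; apply/orP; left; apply/eqP; ring.
Qed.

End CircleIntegral.

(** * Uniform limits of Laurent polynomials on a torus *)

Section Torus.
Variables (R : realType) (r : R).
Hypothesis r_gt0 : 0 < r.
Local Notation C := R[i].

Definition torus n (xi : 'I_n -> C) : Prop := forall i, normc (xi i) = r.

Lemma torus_neq0 n (xi : 'I_n -> C) i : torus xi -> xi i != 0.
Proof. by move=> T; rewrite -normc_eq0 T gt_eqF. Qed.

Definition monomial n (m : 'I_n -> int) (xi : 'I_n -> C) : C := \prod_i xi i ^ m i.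

Definition laurent n (p : seq (C * ('I_n -> int))) (xi : 'I_n -> C) : C :=
  \sum_(a <- p) a.1 * monomial a.2 xi.

(** The value of the contour integral of the polynomial, each differential
    including its factor [1/(2 pi i)]. *)
Definition residue n (p : seq (C * ('I_n -> int))) : C :=
  \sum_(a <- p | [forall i, a.2 i == -1]) a.1.

(** Uniform limits, on the torus, of Laurent polynomials with exponents in [P].
    The predicate [P] is either everything or the vectors with nonpositive
    entries. *)
Definition laurent_limit n (P : pred ('I_n -> int)) (F : ('I_n -> C) -> C) : Prop :=
  forall e, 0 < e -> exists2 p, all (fun a => P a.2) p &
    forall xi, torus xi -> normc (F xi - laurent p xi) <= e.

Lemma laurent_limitW n (P Q : pred ('I_n -> int)) F :
  (forall m, P m -> Q m) -> laurent_limit P F -> laurent_limit Q F.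
Proof.
move=> PQ hF e e0; have [p hp hFp] := hF e e0; exists p => //.
by apply: sub_all hp => a; exact: PQ.
Qed.

Lemma eq_laurent_limit n (P : pred ('I_n -> int)) F G :
  (forall xi, torus xi -> F xi = G xi) -> laurent_limit P F -> laurent_limit P G.
Proof.
move=> FG hF e e0; have [p hp hFp] := hF e e0; exists p => // xi T.
by rewrite -FG // hFp.
Qed.

Lemma torus_fcons n (z : C) (xi : 'I_n -> C) :
  normc z = r -> torus xi -> torus (fcons z xi).
Proof. by move=> hz T i; rewrite /fcons; case: unliftP. Qed.

Lemma fcons0 n (z : C) (xi : 'I_n -> C) : fcons z xi ord0 = z.
Proof. by rewrite /fcons unlift_none. Qed.

Lemma fconsS n (z : C) (xi : 'I_n -> C) i : fcons z xi (lift ord0 i) = xi i.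
Proof. by rewrite /fcons liftK. Qed.

Lemma forall_ord_recl n (A : pred 'I_n.+1) :
  [forall i, A i] = A ord0 && [forall i, A (lift ord0 i)].
Proof.
apply/forallP/andP => [h|[h0 /forallP hS] i]; first by split => //; apply/forallP.
by case: (unliftP ord0 i) => [j ->|->].
Qed.

(** Induction on the number of variables.  If [p] approximates [F] on the torus,
    then for [z] on the circle [p(z, -)] approximates [F(z, -)], and by induction
    the inner integral of [F] is approximated by a Laurent polynomial in [z],
    collected by [outer], whose residue is that of [p]. *)
Lemma multi_integral_approx n (F : ('I_n -> C) -> C) : laurent_limit predT F ->
  forall p e, (forall xi, torus xi -> normc (F xi - laurent p xi) <= e) ->
  normc (multi_circle_integral r F - residue p) <= (2 * r) ^+ n * e.
Proof.
elim: n F => [|n IHn] F hF p e hp.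
  rewrite expr0 mul1r /= (_ : residue p = laurent p (fun=> 0)).
    by apply: hp; case.
  rewrite /residue /laurent big_mkcond; apply: eq_bigr => a _.
  rewrite /monomial big_ord0 mulr1 ifT //.
  by apply/forallP; case.
(* slice fixes the first variable; outer keeps the monomials whose other exponents
   are -1, as monomials in the first variable *)
pose slice z (q : seq (C * ('I_n.+1 -> int))) :=
  [seq (a.1 * z ^ (a.2 ord0), fun i => a.2 (lift ord0 i)) | a <- q].
pose outer (q : seq (C * ('I_n.+1 -> int))) :=
  [seq (a.1, a.2 ord0) | a <- q & [forall i, a.2 (lift ord0 i) == -1]].
have sliceE z q xi : laurent (slice z q) xi = laurent q (fcons z xi).
  rewrite /laurent big_map; apply: eq_bigr => a _.
  rewrite /monomial big_ord_recl fcons0 -mulrA; congr (_ * (_ * _)).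
  by apply: eq_bigr => i _; rewrite fconsS.
have outerE z q : residue (slice z q) = laurent1 (outer q) z.
  by rewrite /residue /laurent1 !big_map big_filter.
have residueE q : residue1 (outer q) = residue q.
  rewrite /residue1 /residue big_map big_filter_cond; apply: eq_bigl => a.
  by rewrite forall_ord_recl andbC.
have key q d : (forall xi, torus xi -> normc (F xi - laurent q xi) <= d) ->
  forall z, normc z = r ->
  normc (multi_circle_integral r (fun xi => F (fcons z xi)) - laurent1 (outer q) z)
    <= (2 * r) ^+ n * d.
  move=> hq z hz; rewrite -outerE; apply: IHn => [d' d'0|xi T].
    have [q' _ hq'] := hF d' d'0.
    by exists (slice z q'); [exact/all_predT|move=> xi T; rewrite sliceE; apply/hq'/torus_fcons].
  by rewrite sliceE; apply/hq/torus_fcons.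
have r2 : 0 < (2 * r) ^+ n by rewrite exprn_gt0 // mulr_gt0.
rewrite -residueE exprS -mulrA; apply: circle_integral_approx => //; last exact: key.
move=> d d0; have [q _ hq] := hF _ (divr_gt0 d0 r2).
exists (outer q) => z hz; rewrite (le_trans (key _ _ hq z hz)) //.
by rewrite mulrC divfK // gt_eqF.
Qed.

Section Closure.
Variables (n : nat) (P : pred ('I_n -> int)).
Hypothesis P0 : P (fun=> 0).
Hypothesis PD : forall m m', P m -> P m' -> P (fun i => m i + m' i).
Implicit Types F G : ('I_n -> C) -> C.

Lemma laurent_limit_monomial m : P m -> laurent_limit P (monomial m).
Proof.
move=> Pm e e0; exists [:: (1, m)]; first by rewrite /= Pm.
move=> xi T; rewrite /laurent big_seq1 /= mul1r subrr ComplexField.Normc.normc0.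
exact: ltW.
Qed.

Lemma laurent_limit_cst z : laurent_limit P (fun=> z).
Proof.
move=> e e0; exists [:: (z, fun=> 0)]; first by rewrite /= P0.
move=> xi T; rewrite /laurent big_seq1 /= /monomial big1 => [|i _]; last exact: expr0z.
by rewrite mulr1 subrr ComplexField.Normc.normc0 ltW.
Qed.

Lemma laurent_limit_coord i k :
  P (fun j => if j == i then k else 0) -> laurent_limit P (fun xi => xi i ^ k).
Proof.
move=> /laurent_limit_monomial; apply: eq_laurent_limit => xi T.
rewrite /monomial (bigD1 i) //= eqxx big1 ?mulr1 // => j /negPf ->.
exact: expr0z.
Qed.

Lemma laurent_limitD F G :
  laurent_limit P F -> laurent_limit P G -> laurent_limit P (fun xi => F xi + G xi).
Proof.
move=> hF hG e e0; have e2 : 0 < e / 2 by rewrite divr_gt0.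
have [p pP hp] := hF _ e2; have [q qP hq] := hG _ e2.
exists (p ++ q); first by rewrite all_cat pP.
move=> xi T; rewrite /laurent big_cat /= opprD addrACA.
by rewrite (le_trans (ler_normcD _ _)) // [e]splitr lerD ?hp ?hq.
Qed.

Lemma normc_monomial m (xi : 'I_n -> C) : torus xi -> normc (monomial m xi) = r ^ (\sum_i m i).
Proof.
move=> T; rewrite /monomial normc_prod.
rewrite (eq_bigr (fun i => r ^ m i)) => [|i _]; last by rewrite normc_exprz T.
elim/big_rec2: _ => [|i x y _ ->]; first by rewrite expr0z.
by rewrite expfzDr // gt_eqF.
Qed.

Lemma laurent_limit_bounded F : laurent_limit P F ->
  exists2 B, 0 < B & forall xi, torus xi -> normc (F xi) <= B.
Proof.
move=> hF; have [p _ hp] := hF 1 ltr01.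
exists (1 + \sum_(a <- p) normc a.1 * r ^ (\sum_i a.2 i)).
  rewrite ltr_pwDl ?ltr01 //; apply: sumr_ge0 => a _.
  by rewrite mulr_ge0 ?normc_ge0 // exprz_ge0 // ltW.
move=> xi T; rewrite -[F xi](subrK (laurent p xi)) (le_trans (ler_normcD _ _)) //.
rewrite lerD ?hp // (le_trans (normc_sum _ _ _)) //; apply: ler_sum => a _.
by rewrite ComplexField.Normc.normcM normc_monomial.
Qed.

Lemma laurent_limitM F G :
  laurent_limit P F -> laurent_limit P G -> laurent_limit P (fun xi => F xi * G xi).
Proof.
move=> hF hG e e0.
have [B B0 hB] := laurent_limit_bounded hF.
have eB : 0 < e / 2 / B by rewrite !divr_gt0.
have [q qP hq] := hG _ eB.
have [D D0 hD] := laurent_limit_bounded hG.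
have eD : 0 < e / 2 / (D + e / 2 / B) by rewrite !divr_gt0 // addr_gt0.
have [p pP hp] := hF _ eD.
exists [seq (a.1 * b.1, fun i => a.2 i + b.2 i) | a <- p, b <- q].
  move: pP {hp}; elim: p => //= a p IHp /andP[Pa pP].
  rewrite all_cat IHp // andbT all_map; apply: sub_all qP => b Pb; exact: PD.
move=> xi T.
have -> : laurent [seq (a.1 * b.1, fun i => a.2 i + b.2 i) | a <- p, b <- q] xi =
    laurent p xi * laurent q xi.
  rewrite /laurent big_allpairs_dep /= mulr_suml; apply: eq_bigr => a _.
  rewrite mulr_sumr; apply: eq_bigr => b _; rewrite mulrACA; congr (_ * _).
  rewrite /monomial -big_split; apply: eq_bigr => i _.
  by rewrite expfzDr // torus_neq0.
have -> : F xi * G xi - laurent p xi * laurent q xi =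
    F xi * (G xi - laurent q xi) + (F xi - laurent p xi) * laurent q xi by ring.
rewrite (le_trans (ler_normcD _ _)) // !ComplexField.Normc.normcM [e]splitr lerD //.
  apply: (@le_trans _ _ (B * (e / 2 / B))).
    by rewrite ler_pM ?normc_ge0 ?hB ?hq.
  by rewrite mulrC divfK // gt_eqF.
apply: (@le_trans _ _ (e / 2 / (D + e / 2 / B) * (D + e / 2 / B))).
  rewrite ler_pM ?normc_ge0 ?hp //.
  have -> : laurent q xi = G xi - (G xi - laurent q xi) by ring.
  rewrite (le_trans (ler_normcB _ _)) //.
  by rewrite lerD ?hD ?hq.
by rewrite divfK // gt_eqF // addr_gt0.
Qed.

Lemma laurent_limit_sum (I : Type) (s : seq I) (Q : pred I) (F : I -> ('I_n -> C) -> C) :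
  (forall i, Q i -> laurent_limit P (F i)) ->
  laurent_limit P (fun xi => \sum_(i <- s | Q i) F i xi).
Proof.
move=> hF; elim: s => [|i s IHs].
  by under eq_fun do rewrite big_nil; exact: laurent_limit_cst.
under eq_fun do rewrite big_cons; case Qi: (Q i) => //.
by apply: laurent_limitD => //; exact: hF.
Qed.

Lemma laurent_limit_prod (I : Type) (s : seq I) (Q : pred I) (F : I -> ('I_n -> C) -> C) :
  (forall i, Q i -> laurent_limit P (F i)) ->
  laurent_limit P (fun xi => \prod_(i <- s | Q i) F i xi).
Proof.
move=> hF; elim: s => [|i s IHs].
  by under eq_fun do rewrite big_nil; exact: laurent_limit_cst.
under eq_fun do rewrite big_cons; case Qi: (Q i) => //.
by apply: laurent_limitM => //; exact: hF.
Qed.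

Lemma laurent_limitX F k : laurent_limit P F -> laurent_limit P (fun xi => F xi ^+ k).
Proof.
move=> hF; elim: k => [|k IHk].
  by under eq_fun do rewrite expr0; exact: laurent_limit_cst.
by under eq_fun do rewrite exprS; exact: laurent_limitM.
Qed.

Lemma laurent_limit_uniform F :
  (forall e, 0 < e -> exists2 G, laurent_limit P G &
     forall xi, torus xi -> normc (F xi - G xi) <= e) -> laurent_limit P F.
Proof.
move=> hF e e0; have e2 : 0 < e / 2 by rewrite divr_gt0.
have [G hG hFG] := hF _ e2; have [p pP hp] := hG _ e2.
exists p => // xi T; rewrite -[F xi](subrK (G xi)) -addrA.
by rewrite (le_trans (ler_normcD _ _)) // [e]splitr lerD ?hFG ?hp.
Qed.

(** Partial sums of the geometric series converge uniformly when [|F| <= q < 1]. *)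
Lemma laurent_limit_geom F q : q < 1 -> laurent_limit P F ->
  (forall xi, torus xi -> normc (F xi) <= q) ->
  laurent_limit P (fun xi => (1 - F xi)^-1).
Proof.
move=> q1 hF Fq; apply: laurent_limit_uniform => e e0.
pose q' := Num.max q 0.
have q'0 : 0 <= q' by rewrite le_max lexx orbT.
have q'1 : q' < 1 by rewrite gt_max q1 ltr01.
have q1' : 0 < 1 - q' by rewrite subr_gt0.
have Fq' xi : torus xi -> normc (F xi) <= q' by move=> T; rewrite le_max Fq.
have [K hK] : exists K : nat, q' ^+ K <= e * (1 - q').
  have : q' ^+ K @[K --> \oo] --> 0 by apply: cvg_expr; rewrite ger0_norm.
  move/cvgr0Pnorm_le => /(_ _ (mulr_gt0 e0 q1'))[K _ hK]; exists K.
  by have := hK K (leqnn K); rewrite ger0_norm // exprn_ge0.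
exists (fun xi => \sum_(k < K) F xi ^+ k).
  by apply: laurent_limit_sum => k _; exact: laurent_limitX.
move=> xi T.
have lb : 1 - q' <= normc (1 - F xi).
  rewrite lerBlDr; apply: (@le_trans _ _ (normc (1 - F xi) + normc (F xi))).
    by rewrite (le_trans _ (ler_normcD _ _)) // subrK ComplexField.Normc.normc1.
  by rewrite lerD2l Fq'.
have nz : 1 - F xi != 0 by rewrite -normc_eq0 gt_eqF // (lt_le_trans q1').
have -> : (1 - F xi)^-1 - \sum_(k < K) F xi ^+ k = F xi ^+ K / (1 - F xi).
  apply: (mulfI nz); rewrite mulrBr divff // [RHS]mulrC divfK //.
  by rewrite -[1 - F xi]opprB mulNr opprK -subrX1 addrC subrK.
rewrite ComplexField.Normc.normcM ComplexField.Normc.normcV normcX.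
rewrite ler_pdivrMr ?(lt_le_trans q1') //.
apply: (@le_trans _ _ (q' ^+ K)).
  by apply: lerXn2r; rewrite ?nnegrE ?normc_ge0 ?Fq'.
by rewrite (le_trans hK) // ler_pM2l.
Qed.

(** [F] is bounded on the torus, so the exponential series converges uniformly on
    its values. *)
Lemma laurent_limit_cexp F : laurent_limit P F -> laurent_limit P (fun xi => cexp (F xi)).
Proof.
move=> hF; apply: laurent_limit_uniform => e e0.
have [B B0 hB] := laurent_limit_bounded hF.
have eB : 0 < e / expR B by rewrite divr_gt0 ?expR_gt0.
have [K hK] := divided_power_cvg0 (2 * B) eB.
exists (fun xi => exp_partial K (F xi)).
  apply: laurent_limit_sum => k _; apply: laurent_limitM; first exact: laurent_limit_cst.
  exact: laurent_limitX.
move=> xi T; apply: (le_trans (cexp_taylor _ _)).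
apply: (@le_trans _ _ (expR B * (e / expR B))); last first.
  by rewrite mulrC divfK // gt_eqF ?expR_gt0.
have dp0 x : 0 <= x -> 0 <= divided_power K x by exact: divided_power_ge0.
apply: ler_pM; rewrite ?expR_ge0 ?ler_expR ?hB ?dp0 ?mulr_ge0 ?normc_ge0 //.
apply: le_trans (hK K (leqnn _)); apply: le_trans (ler_norm _).
rewrite /divided_power ler_pM2r ?invr_gt0 ?ltr0n ?fact_gt0 //.
by apply: lerXn2r; rewrite ?nnegrE ?mulr_ge0 ?normc_ge0 ?ler_pM2l ?hB // ltW.
Qed.

End Closure.
End Torus.

(** * The iterated contour integral as a coefficient functional *)

Section ConstantTerm.
Variables (R : realType) (r : R) (n : nat).
Hypothesis r_gt0 : 0 < r.
Local Notation C := R[i].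
Local Notation limit := (laurent_limit r).
Local Notation integral := (multi_circle_integral r).
Implicit Types F G : ('I_n -> C) -> C.

Definition nonpositive : pred ('I_n -> int) := fun m => [forall i, m i <= 0].

Lemma nonpositive0 : nonpositive (fun=> 0).
Proof. by apply/forallP. Qed.

Lemma nonpositiveD m m' :
  nonpositive m -> nonpositive m' -> nonpositive (fun i => m i + m' i).
Proof.
move=> /forallP h /forallP h'; apply/forallP => i.
by rewrite -[0]addr0 lerD.
Qed.

Lemma multi_integral_unique F v (K : R) : limit predT F ->
  (forall e, 0 < e -> exists2 p, forall xi, torus r xi -> normc (F xi - laurent p xi) <= e &
     normc (v - residue p) <= K * e) ->
  integral F = v.
Proof.
move=> hF hv; apply/eqP; rewrite -subr_eq0; apply/eqP.
apply: (@normc_le_eps _ _ ((2 * r) ^+ n + K)) => e e0.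
have [p hp hvp] := hv e e0.
have -> : integral F - v = (integral F - residue p) - (v - residue p) by ring.
rewrite (le_trans (ler_normcB _ _)) // mulrDl lerD //.
exact: (multi_integral_approx r_gt0).
Qed.

Lemma eq_multi_integral F G : limit predT F ->
  (forall xi, torus r xi -> F xi = G xi) -> integral F = integral G.
Proof.
move=> hF FG; apply: (@multi_integral_unique _ _ ((2 * r) ^+ n)) => // e e0.
have [p _ hp] := hF e e0; exists p => //.
apply: (multi_integral_approx r_gt0) => [|xi T]; last by rewrite -FG // hp.
exact: eq_laurent_limit hF.
Qed.

Lemma normc_multi_integral F B : limit predT F ->
  (forall xi, torus r xi -> normc (F xi) <= B) -> normc (integral F) <= (2 * r) ^+ n * B.
Proof.
move=> hF hB; have := multi_integral_approx r_gt0 hF (p := [::]) (e := B).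
rewrite /residue /laurent big_nil subr0; apply => xi T.
by rewrite big_nil subr0 hB.
Qed.

Lemma multi_integral_linear a F G : limit predT F -> limit predT G ->
  integral (fun xi => a * F xi + G xi) = a * integral F + integral G.
Proof.
move=> hF hG; apply: (@multi_integral_unique _ _ ((2 * r) ^+ n)) => [|e e0].
  by apply: laurent_limitD => //; apply: laurent_limitM => //; exact: laurent_limit_cst.
have a1 : 0 < normc a + 1 by rewrite ltr_wpDl ?normc_ge0.
have ea : 0 < e / (normc a + 1) by rewrite divr_gt0.
have [p _ hp] := hF _ ea; have [q _ hq] := hG _ ea.
have eE : e = normc a * (e / (normc a + 1)) + e / (normc a + 1).
  by rewrite -[X in _ + X]mul1r -mulrDl mulrC divfK // gt_eqF.
exists ([seq (a * b.1, b.2) | b <- p] ++ q) => [xi T|].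
  have -> : laurent ([seq (a * b.1, b.2) | b <- p] ++ q) xi = a * laurent p xi + laurent q xi.
    rewrite /laurent big_cat big_map /= mulr_sumr; congr (_ + _).
    by apply: eq_bigr => b _; rewrite mulrA.
  have -> : a * F xi + G xi - (a * laurent p xi + laurent q xi) =
    a * (F xi - laurent p xi) + (G xi - laurent q xi) by ring.
  rewrite (le_trans (ler_normcD _ _)) // ComplexField.Normc.normcM eE.
  by rewrite lerD ?hq // ler_wpM2l ?normc_ge0 ?hp.
have -> : residue ([seq (a * b.1, b.2) | b <- p] ++ q) = a * residue p + residue q.
  by rewrite /residue big_cat big_map /= mulr_sumr.
have -> : a * integral F + integral G - (a * residue p + residue q) =
  a * (integral F - residue p) + (integral G - residue q) by ring.
rewrite (le_trans (ler_normcD _ _)) // ComplexField.Normc.normcM eE mulrDr lerD //.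
  by rewrite mulrCA ler_wpM2l ?normc_ge0 // (multi_integral_approx r_gt0).
exact: (multi_integral_approx r_gt0).
Qed.

Lemma multi_integral0 : @multi_circle_integral R r n (fun=> 0) = 0.
Proof.
apply/eqP; rewrite -normc_eq0 eq_le normc_ge0 andbT -(mulr0 ((2 * r) ^+ n)).
apply: normc_multi_integral; first exact: laurent_limit_cst.
by move=> xi T; rewrite ComplexField.Normc.normc0.
Qed.

Lemma multi_integralZ a F : limit predT F ->
  integral (fun xi => a * F xi) = a * integral F.
Proof.
move=> hF; have := multi_integral_linear a hF (@laurent_limit_cst _ r n predT isT 0).
by under eq_fun do rewrite addr0; rewrite multi_integral0 addr0.
Qed.

Lemma multi_integralD F G : limit predT F -> limit predT G ->
  integral (fun xi => F xi + G xi) = integral F + integral G.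
Proof.
move=> hF hG; have := multi_integral_linear 1 hF hG.
by under eq_fun do rewrite mul1r; rewrite mul1r.
Qed.

Lemma multi_integral_sum (I : Type) (s : seq I) (F : I -> ('I_n -> C) -> C) :
  (forall i, limit predT (F i)) ->
  integral (fun xi => \sum_(i <- s) F i xi) = \sum_(i <- s) integral (F i).
Proof.
move=> hF; elim: s => [|i s IHs].
  by under eq_fun do rewrite big_nil; rewrite multi_integral0 big_nil.
under eq_fun do rewrite big_cons.
rewrite multi_integralD ?big_cons ?IHs //.
exact: laurent_limit_sum.
Qed.

(** On Laurent polynomials the residue is invariant under permutations of the
    variables; the invariance passes to uniform limits. *)
Lemma multi_integral_relabel F (s : 'S_n) : limit predT F ->
  integral (fun xi => F (fun i => xi (s i))) = integral F.
Proof.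
move=> hF.
pose rel (p : seq (C * ('I_n -> int))) := [seq (a.1, fun i => a.2 ((s^-1)%g i)) | a <- p].
have relE p xi : laurent (rel p) xi = laurent p (fun i => xi (s i)).
  rewrite /laurent big_map; apply: eq_bigr => a _; congr (_ * _).
  rewrite /monomial /= (reindex_inj (@perm_inj _ s)); apply: eq_bigr => i _.
  by rewrite permK.
have hrel p e : (forall xi, torus r xi -> normc (F xi - laurent p xi) <= e) ->
    forall xi, torus r xi -> normc (F (fun i => xi (s i)) - laurent (rel p) xi) <= e.
  by move=> hp xi T; rewrite relE; apply: hp => i.
apply: (@multi_integral_unique _ _ ((2 * r) ^+ n)) => [e e0|e e0].
  have [p _ hp] := hF e e0; exists (rel p); last exact: hrel.
  exact/all_predT.
have [p _ hp] := hF e e0; exists (rel p); first exact: hrel.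
have -> : residue (rel p) = residue p.
  rewrite /residue big_map; apply: eq_bigl => a /=.
  apply/forallP/forallP => h i; last exact: h.
  by have := h (s i); rewrite permK.
exact: (multi_integral_approx r_gt0).
Qed.

Lemma multi_integral_monomial (m : 'I_n -> int) : integral (monomial m) = [forall i, m i == -1]%:R.
Proof.
apply: (@multi_integral_unique _ _ ((2 * r) ^+ n)) => [|e e0].
  exact: laurent_limit_monomial.
exists [:: (1, m)].
  move=> xi T; rewrite /laurent big_seq1 /= mul1r subrr ComplexField.Normc.normc0.
  exact: ltW.
rewrite /residue big_mkcond big_seq1; case: ifP => _;
  by rewrite subrr ComplexField.Normc.normc0 mulr_ge0 ?exprn_ge0 ?mulr_ge0 ?ltW.
Qed.

(** In the approximations of [F], multiplied by [monomial m], no monomial has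
    exponent -1 in the [j]-th variable. *)
Lemma multi_integral_eq0 F (m : 'I_n -> int) j : limit nonpositive F -> m j <= -2 ->
  integral (fun xi => F xi * monomial m xi) = 0.
Proof.
move=> hF mj.
apply: (@multi_integral_unique _ _ 0) => [|e e0].
  apply: laurent_limitM => //; last exact: laurent_limit_monomial.
  exact: laurent_limitW hF.
have rm : 0 < r ^ (\sum_i m i) by rewrite exprz_gt0.
have [p pP hp] := hF _ (divr_gt0 e0 rm).
exists [seq (a.1, fun i => a.2 i + m i) | a <- p] => [xi T|].
  have -> : laurent [seq (a.1, fun i => a.2 i + m i) | a <- p] xi =
      laurent p xi * monomial m xi.
    rewrite /laurent big_map mulr_suml; apply: eq_bigr => a _.
    rewrite -mulrA; congr (_ * _); rewrite /monomial -big_split.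
    by apply: eq_bigr => i _; rewrite /= expfzDr // (torus_neq0 r_gt0).
  rewrite -mulrBl ComplexField.Normc.normcM (normc_monomial r_gt0) //.
  by rewrite -ler_pdivlMr // hp.
have -> : residue [seq (a.1, fun i => a.2 i + m i) | a <- p] = 0.
  rewrite /residue big_map; elim: p pP {hp} => [|a p IHp] /=; first by rewrite big_nil.
  move=> /andP[/forallP ha hp]; rewrite big_cons IHp // ifF //.
  apply/negbTE/negP => /forallP /(_ j) /eqP.
  by have := ha j; lia.
by rewrite subrr ComplexField.Normc.normc0 mul0r.
Qed.

End ConstantTerm.

(** * The S-factors on the torus *)

Section ScatteringFactor.
Variables (R : realType) (N : nat) (Delta r : R).
Hypothesis r_gt0 : 0 < r.
Hypothesis hpoles : poles_inside N Delta r.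
Local Notation C := R[i].

(** If the inequality failed, the denominator would vanish at
    [xi_beta = +-(2|Delta| + 1/r)] and [xi_alpha = -+r], the sign being that of
    [Delta], and both points have modulus at least [r]. *)
Lemma poles_inside_lt1 (alpha beta : 'I_N) : (alpha < beta)%N ->
  2 * `|Delta| / r + (r ^+ 2)^-1 < 1.
Proof.
move=> ab; rewrite ltNge; apply/negP => h.
pose sg : R := if 0 <= Delta then 1 else -1.
have sgD : sg * `|Delta| = Delta.
  by rewrite /sg; case: ger0P => _; rewrite ?mul1r ?mulN1r ?opprK.
have sg2 : sg * sg = 1 by rewrite /sg; case: ifP => _; rewrite ?mulN1r ?mulr1 ?opprK.
have nsg : `|sg| = 1 by rewrite /sg; case: ifP => _; rewrite ?normrN ?normr1.
pose xb : C := (sg * (2 * `|Delta| + r^-1))%:C.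
pose xa : C := (- sg * r)%:C.
have rn0 : r != 0 by rewrite gt_eqF.
have := hpoles (alpha := alpha) (beta := beta)
  (xi := fun i => if i == alpha then xa else xb) ab.
rewrite eqxx ifF; last by apply/negbTE/eqP => E; rewrite E ltnn in ab.
rewrite !normc_real !normrM normrN nsg !mul1r (gtr0_norm r_gt0) lexx.
rewrite ger0_norm ?addr_ge0 ?mulr_ge0 ?invr_ge0 ?(ltW r_gt0) //.
have -> : r <= 2 * `|Delta| + r^-1.
  rewrite -[leLHS]mul1r -ler_pdivlMr //; apply: (le_trans h).
  by rewrite [leRHS]mulrDl expr2 invfM.
move=> /(_ isT isT) /negP; apply; apply/eqP.
have -> : 1 + xa * xb - 2 * Delta%:C * xa =
    (1 + (- sg * r) * (sg * (2 * `|Delta| + r^-1)) - 2 * Delta * (- sg * r))%:C.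
  by rewrite /xa /xb; apply: complexP => /=; ring.
rewrite -[X in 2 * X * _]sgD.
have -> : 1 + - sg * r * (sg * (2 * `|Delta| + r^-1)) - 2 * (sg * `|Delta|) * (- sg * r) =
  1 - (sg * sg) * (r * r^-1) by ring.
by rewrite sg2 divff // mul1r subrr.
Qed.

Lemma Sfactor_denominator (alpha beta : 'I_N) (xi : 'I_N -> C) : (alpha < beta)%N ->
  torus r xi -> 1 + xi alpha * xi beta - 2 * Delta%:C * xi alpha != 0.
Proof. by move=> ab T; apply: hpoles ab _ _; rewrite T. Qed.

(** After division by [xi_alpha xi_beta] the denominator is [1 - w] with
    [w = 2 Delta/xi_beta - 1/(xi_alpha xi_beta)], and [poles_inside_lt1] bounds
    [w] by a constant less than 1. *)
Lemma laurent_limit_Sfactor (alpha beta : 'I_N) : (alpha < beta)%N ->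
  laurent_limit r (@nonpositive N) (fun xi => Sfactor Delta (xi beta) (xi alpha)).
Proof.
move=> ab; have q1 := poles_inside_lt1 ab.
have P0 := @nonpositive0 N; have PD := @nonpositiveD N.
pose w (xi : 'I_N -> C) := 2 * Delta%:C * xi beta ^ (-1) - xi alpha ^ (-1) * xi beta ^ (-1).
have hinv i : laurent_limit r (@nonpositive N) (fun xi => xi i ^ (-1)).
  by apply: laurent_limit_coord => //; apply/forallP => j; case: ifP.
have hN F : laurent_limit r (@nonpositive N) F -> laurent_limit r (@nonpositive N) (fun xi => - F xi).
  move=> hF; under eq_fun do rewrite -mulN1r.
  by apply: laurent_limitM => //; exact: laurent_limit_cst.
have hcst := laurent_limit_cst r P0.
have hw : laurent_limit r (@nonpositive N) w.
  by apply: laurent_limitD; [|apply: hN]; apply: laurent_limitM.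
have wq xi : torus r xi -> normc (w xi) <= 2 * `|Delta| / r + (r ^+ 2)^-1.
  move=> T; rewrite (le_trans (ler_normcB _ _)) // !ComplexField.Normc.normcM.
  rewrite !normc_exprz !T !normc_real -(rmorph_nat (real_complex R)) normc_real normr_nat.
  by rewrite !exprN1 expr2 invfM.
apply: (eq_laurent_limit (F := fun xi =>
  - ((1 + xi alpha ^ (-1) * xi beta ^ (-1) - 2 * Delta%:C * xi alpha ^ (-1)) * (1 - w xi)^-1))).
  move=> xi T; have a0 := torus_neq0 r_gt0 alpha T; have b0 := torus_neq0 r_gt0 beta T.
  have d0 := Sfactor_denominator ab T.
  have dE : 1 - w xi = (1 + xi alpha * xi beta - 2 * Delta%:C * xi alpha) / (xi alpha * xi beta).
    by rewrite /w !exprN1; field; rewrite a0 b0.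
  rewrite /Sfactor dE !exprN1; field.
  by rewrite d0 a0 b0.
apply/hN; apply: laurent_limitM => //; last exact: laurent_limit_geom wq.
by apply: laurent_limitD => //; [apply: laurent_limitD|apply: hN] => //; apply: laurent_limitM.
Qed.

Lemma laurent_limit_Acoef (s : 'S_N) : laurent_limit r (@nonpositive N) (Acoef Delta s).
Proof.
apply: laurent_limit_prod => //; [exact: nonpositive0|exact: nonpositiveD|].
by case=> b a /andP[ab _]; exact: laurent_limit_Sfactor.
Qed.

End ScatteringFactor.

(** * The coefficients of the Bethe ansatz *)

Section OrderedPairs.
Variables (F : fieldType) (n : nat).
Implicit Types (g : 'I_n -> 'I_n -> F) (s : 'S_n).

(** Permuting the entries replaces [g a b] with [g b a] exactly at the inverted
    pairs. *)
Lemma prod_inversion g s : (forall a b : 'I_n, (a < b)%N -> g a b != 0) ->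
  \prod_(p : 'I_n * 'I_n | (p.1 < p.2)%N) g (s p.1) (s p.2) =
  \prod_(p : 'I_n * 'I_n | (p.1 < p.2)%N) g p.1 p.2 *
  \prod_(p : 'I_n * 'I_n | inversion s p.1 p.2) (g p.1 p.2 / g p.2 p.1).
Proof.
move=> g0.
have sinj : injective (fun p : 'I_n * 'I_n => ((s^-1)%g p.1, (s^-1)%g p.2)).
  by move=> [a b] [c d] /= [] /perm_inj -> /perm_inj ->.
have swinj : injective (fun p : 'I_n * 'I_n => (p.2, p.1)).
  by move=> [a b] [c d] /= [-> ->].
rewrite (reindex_inj sinj) /=.
under eq_bigr do rewrite !permKV.
rewrite (bigID (fun p : 'I_n * 'I_n => (p.1 < p.2)%N)) /=.
rewrite [in RHS](bigID (fun p : 'I_n * 'I_n => ((s^-1)%g p.1 < (s^-1)%g p.2)%N)) /=.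
rewrite -mulrA; congr (_ * _); first by apply: eq_bigl => p; rewrite andbC.
have lt_neq (a b : 'I_n) : (a < b)%N -> ((s^-1)%g a < (s^-1)%g b)%N = ~~ ((s^-1)%g b < (s^-1)%g a)%N.
  move=> ab; have ne : (s^-1)%g a != (s^-1)%g b :> nat.
    by apply/eqP => /ord_inj/perm_inj e; move: ab; rewrite e ltnn.
  by rewrite -leqNgt [RHS]leq_eqVlt (negPf ne).
rewrite [X in X * _](reindex_inj swinj) /=.
rewrite [X in X * _](_ : _ =
  \prod_(p : 'I_n * 'I_n | inversion s p.1 p.2) g p.2 p.1); last first.
  apply: eq_bigl => p; rewrite /inversion.
  by case: (boolP (p.2 < p.1)%N) => //= /lt_neq ->; rewrite negbK.
rewrite -big_split /=; apply: eq_big => [p|p].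
  rewrite /inversion; apply/andP/andP => -[h1 h2]; split => //.
    rewrite ltn_neqAle leqNgt h2 andbT.
    by apply/eqP => /ord_inj e; move: h1; rewrite e ltnn.
  by rewrite -leqNgt ltnW.
move=> /andP[lt12 ge12]; rewrite mulrCA divff ?mulr1 // g0 //.
rewrite ltn_neqAle leqNgt ge12 andbT.
by apply/eqP => /ord_inj e; move: lt12; rewrite e ltnn.
Qed.

(** The transposition of two neighbours permutes the ordered pairs, except that it
    reverses the pair it exchanges. *)
Lemma prod_pair_tperm g (i j : 'I_n) : j = i.+1 :> nat ->
  \prod_(p : 'I_n * 'I_n | (p.1 < p.2)%N) g (tperm i j p.1) (tperm i j p.2) * g i j =
  \prod_(p : 'I_n * 'I_n | (p.1 < p.2)%N) g p.1 p.2 * g j i.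
Proof.
move=> ij; pose h p := (tperm i j p.1, tperm i j p.2).
have hinj : injective h by move=> [a b] [c d] [] /perm_inj -> /perm_inj ->.
have ltij : (i < j)%N by rewrite ij.
rewrite (bigD1 (i, j)) //= tpermL tpermR [in RHS](bigD1 (i, j)) //=.
rewrite mulrAC [RHS]mulrAC [g j i * _]mulrC; congr (_ * _).
rewrite [RHS](reindex_inj hinj) /=; apply: eq_bigl => -[a b] /=.
have tv (c : 'I_n) : [\/ c = i :> nat /\ tperm i j c = j :> nat,
    c = j :> nat /\ tperm i j c = i :> nat |
    [/\ c <> i :> nat, c <> j :> nat & tperm i j c = c :> nat]].
  case: tpermP => [->|->|ci cj]; [by constructor 1|by constructor 2|].
  by constructor 3; split => // /ord_inj.
rewrite /h !xpair_eqE -!val_eqE /=.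
by case: (tv a) => -[]; case: (tv b) => -[]; lia.
Qed.

End OrderedPairs.

Section BetheCoefficients.
Variables (R : realType) (N : nat) (Delta r : R).
Hypothesis r_gt0 : 0 < r.
Hypothesis hpoles : poles_inside N Delta r.
Local Notation C := R[i].
Implicit Types (s : 'S_N) (xi : 'I_N -> C).

Definition bethe_pair (a b : C) : C := 1 + a * b - 2 * Delta%:C * a.

Definition pair_product s xi : C :=
  \prod_(p : 'I_N * 'I_N | (p.1 < p.2)%N) bethe_pair (xi (s p.1)) (xi (s p.2)).

Lemma bethe_pair_neq0 xi (a b : 'I_N) : torus r xi -> (a < b)%N ->
  bethe_pair (xi a) (xi b) != 0.
Proof. by move=> T ab; apply: hpoles ab _ _; rewrite T. Qed.

Lemma pair_product1_neq0 xi : torus r xi -> pair_product 1 xi != 0.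
Proof.
move=> T; rewrite /pair_product prodf_seq_neq0; apply/allP => -[a b] _ /=.
by apply/implyP => ab; rewrite !perm1 bethe_pair_neq0.
Qed.

(** Both sides are the quotient of the Vandermonde products of the points
    [s 0, s 1, ...] and [0, 1, ...]. *)
Lemma sign_inversion s :
  \prod_(p : 'I_N * 'I_N | inversion s p.1 p.2) (-1 : C) = (-1) ^+ s.
Proof.
(* W is a Vandermonde determinant, so permuting its arguments by s multiplies it by
   the sign of s *)
pose W (a : 'I_N -> C) := \prod_(p : 'I_N * 'I_N | (p.1 < p.2)%N) (a p.2 - a p.1).
have det (a : 'rV[C]_N) : \det (Vandermonde N a) = W (fun i => a ord0 i).
  by rewrite det_Vandermonde pair_big_dep.
pose a0 : 'rV[C]_N := \row_i (nat_of_ord i)%:R.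
have a0E (i j : 'I_N) : (i < j)%N -> a0 ord0 j - a0 ord0 i != 0.
  by move=> ij; rewrite !mxE -natrB ?(ltnW ij) // pnatr_eq0 subn_eq0 -ltnNge.
have W0 : W (fun i => a0 ord0 i) != 0.
  by rewrite /W prodf_seq_neq0; apply/allP => -[a b] _ /=; apply/implyP => /a0E.
have Ws : W (fun i => a0 ord0 (s i)) = (-1) ^+ s * W (fun i => a0 ord0 i).
  have -> : W (fun i => a0 ord0 (s i)) = \det (Vandermonde N (col_perm s a0)).
    by rewrite det; apply: eq_bigr => p _; rewrite !mxE.
  have -> : Vandermonde N (col_perm s a0) = col_perm s (Vandermonde N a0).
    by apply/matrixP => i j; rewrite !mxE.
  by rewrite col_permE det_mulmx det_perm odd_permV mulrC -det.
have := prod_inversion (g := fun a b => a0 ord0 b - a0 ord0 a) s a0E.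
rewrite -/(W (fun i => a0 ord0 (s i))) -/(W (fun i => a0 ord0 i)) Ws mulrC.
move=> /(mulfI W0) ->; apply: eq_bigr => -[b a] /andP[/= ab _].
by rewrite -opprB mulNr divff // a0E.
Qed.

(** In this form the dependence on [s] is a sign and a product over all ordered
    pairs, which makes the effect of a transposition on either side visible. *)
Lemma AcoefE s xi : torus r xi ->
  Acoef Delta s xi = (-1) ^+ s * pair_product s xi / pair_product 1 xi.
Proof.
move=> T.
have g0 (a b : 'I_N) : (a < b)%N -> bethe_pair (xi a) (xi b) != 0 by exact: bethe_pair_neq0.
have p1 : pair_product 1 xi =
    \prod_(p : 'I_N * 'I_N | (p.1 < p.2)%N) bethe_pair (xi p.1) (xi p.2).
  by apply: eq_bigr => p _; rewrite !perm1.
rewrite /pair_product (prod_inversion s g0) -p1 -sign_inversion mulrA mulrAC.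
rewrite -/(pair_product 1 xi) mulfK ?pair_product1_neq0 // -big_split.
apply: eq_bigr => p _; rewrite /= mulN1r /Sfactor /bethe_pair.
by rewrite [xi p.1 * xi p.2]mulrC.
Qed.

Variables (i j : 'I_N).
Hypothesis ij : j = i.+1 :> nat.
Let t := tperm i j.

Let neq_ij : i != j.
Proof. by apply/eqP => e; move: ij; rewrite e => /eqP; rewrite eqn_leq ltnn andbF. Qed.

(** The cancellation between [s] and [t * s] at two adjacent outgoing particles. *)
Lemma Acoef_tperm_mul s xi : torus r xi ->
  Acoef Delta (t * s)%g xi * bethe_pair (xi (s i)) (xi (s j)) =
  - (Acoef Delta s xi * bethe_pair (xi (s j)) (xi (s i))).
Proof.
move=> T.
have sg : (-1) ^+ (t * s)%g = - (-1) ^+ s :> C.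
  by rewrite odd_mul_tperm neq_ij addTb signrN.
have e : pair_product (t * s)%g xi * bethe_pair (xi (s i)) (xi (s j)) =
    pair_product s xi * bethe_pair (xi (s j)) (xi (s i)).
  have := prod_pair_tperm (fun a b => bethe_pair (xi (s a)) (xi (s b))) ij.
  by rewrite /pair_product => <-; congr (_ * _); apply: eq_bigr => p _; rewrite !permM.
rewrite !AcoefE // sg !mulNr; congr (- _).
by rewrite mulrAC -[_ * _ * bethe_pair _ _]mulrA e [RHS]mulrAC mulrA.
Qed.

(** The same for two adjacent incoming particles: exchanging the integration
    variables turns the numerator of [s] into that of [s * t], and changes a
    single factor of the common denominator. *)
Lemma Acoef_mul_tperm s xi : torus r xi ->
  Acoef Delta s (fun k => xi (t k)) * bethe_pair (xi j) (xi i) =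
  - (Acoef Delta (s * t)%g xi * bethe_pair (xi i) (xi j)).
Proof.
move=> T; have T' : torus r (fun k => xi (t k)) by move=> k; exact: T.
have h3 := pair_product1_neq0 T; have h4 := pair_product1_neq0 T'.
have sg : (-1) ^+ (s * t)%g = - (-1) ^+ s :> C.
  by rewrite odd_permM odd_tperm neq_ij addbT signrN.
have e1 : pair_product s (fun k => xi (t k)) = pair_product (s * t)%g xi.
  by apply: eq_bigr => p _; rewrite !permM.
have e2 : pair_product 1 (fun k => xi (t k)) * bethe_pair (xi i) (xi j) =
    pair_product 1 xi * bethe_pair (xi j) (xi i).
  have h := prod_pair_tperm (fun a b => bethe_pair (xi a) (xi b)) ij.
  apply: etrans (etrans h _); congr (_ * _).
    by apply: eq_bigr => p _; rewrite !perm1.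
  by apply: eq_bigr => p _; rewrite !perm1.
rewrite !AcoefE // e1 sg !mulNr opprK.
have -> : bethe_pair (xi j) (xi i) =
    pair_product 1 (fun k => xi (t k)) * bethe_pair (xi i) (xi j) / pair_product 1 xi.
  by rewrite e2 mulrC mulKf.
move: h3 h4; move: (pair_product 1 _) (pair_product 1 _) => u v u0 v0.
move: ((-1) ^+ _) (pair_product _ _) (bethe_pair _ _) => a b c.
by field; rewrite u0 v0.
Qed.

End BetheCoefficients.

(** * Bethe functions at arbitrary integer points *)

Section BetheFunction.
Variables (R : realType) (N : nat) (Delta r : R).
Hypothesis r_gt0 : 0 < r.
Hypothesis hpoles : poles_inside N Delta r.
Local Notation C := R[i].
Local Notation limit := (laurent_limit r (@predT ('I_N -> int))).
Local Notation integral := (@multi_circle_integral R r N).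
Implicit Types (s : 'S_N) (xi : 'I_N -> C) (x y : 'I_N -> int) (g : ('I_N -> C) -> C).

Definition step_at x (i : 'I_N) (c : int) : 'I_N -> int :=
  fun k => x k + (if k == i then c else 0).

Definition out_monomial s x xi : C := \prod_k xi (s k) ^ x k.
Definition in_monomial y xi : C := \prod_k xi k ^ (- y k - 1).

Definition bethe_term g s x y xi : C :=
  Acoef Delta s xi * out_monomial s x xi * in_monomial y xi * g xi.

(** [x] and [y] range over all integer vectors, increasing or not, so that a
    particle may be moved onto its neighbour.  [g] is an additional factor of
    the integrand: the time evolution, or a power of the energy. *)
Definition bethe_function g x y : C :=
  \sum_(s : 'S_N) integral (bethe_term g s x y).

Definition total_energy xi : C := \sum_k energy Delta (xi k).

Lemma prod_step_at (a : 'I_N -> C) x i c : (forall k, a k != 0) ->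
  \prod_k a k ^ step_at x i c k = \prod_k a k ^ x k * a i ^ c.
Proof.
move=> a0; rewrite [LHS](bigD1 i) // [in RHS](bigD1 i) //= /step_at eqxx expfzDr //.
rewrite mulrAC; congr (_ * _ * _); apply: eq_bigr => k /negPf ->.
by rewrite addr0.
Qed.

Lemma out_monomial_step_at s x i c xi : torus r xi ->
  out_monomial s (step_at x i c) xi = out_monomial s x xi * xi (s i) ^ c.
Proof.
move=> T; apply: (prod_step_at (a := fun k => xi (s k))) => k.
exact: torus_neq0 T.
Qed.

Lemma in_monomial_step_at y i c xi : torus r xi ->
  in_monomial (step_at y i c) xi = in_monomial y xi * xi i ^ (- c).
Proof.
move=> T; rewrite /in_monomial.
rewrite -(prod_step_at (a := xi) (fun k => - y k - 1)); last by move=> k; exact: torus_neq0 T.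
apply: eq_bigr => k _; congr (_ ^ _); rewrite /step_at.
by case: ifP => _; ring.
Qed.

Lemma out_monomial_mul t s x xi :
  out_monomial (t * s)%g x xi = out_monomial s (fun k => x ((t^-1)%g k)) xi.
Proof.
rewrite /out_monomial [RHS](reindex_inj (@perm_inj _ t)).
by apply: eq_bigr => k _; rewrite permM permK.
Qed.

Lemma in_monomial_relabel (t : 'S_N) y xi :
  in_monomial y (fun k => xi (t k)) = in_monomial (fun k => y ((t^-1)%g k)) xi.
Proof.
rewrite /in_monomial [RHS](reindex_inj (@perm_inj _ t)).
by apply: eq_bigr => k _; rewrite permK.
Qed.

Lemma out_monomialE s x xi :
  out_monomial s x xi = monomial (fun k => x ((s^-1)%g k)) xi.
Proof.
rewrite /out_monomial /monomial [RHS](reindex_inj (@perm_inj _ s)).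
by apply: eq_bigr => k _; rewrite permK.
Qed.

Lemma limitM F G : limit F -> limit G -> limit (fun xi => F xi * G xi).
Proof. exact: laurent_limitM. Qed.

Lemma limit_Acoef s : limit (Acoef Delta s).
Proof. exact: laurent_limitW (laurent_limit_Acoef r_gt0 hpoles s). Qed.

Lemma limit_out_monomial s x : limit (out_monomial s x).
Proof.
rewrite (_ : out_monomial s x = monomial (fun k => x ((s^-1)%g k))).
  exact: laurent_limit_monomial.
by apply/funext => xi; exact: out_monomialE.
Qed.

Lemma limit_in_monomial y : limit (in_monomial y).
Proof. exact: laurent_limit_monomial. Qed.

Lemma limit_term g s x y : limit g -> limit (bethe_term g s x y).
Proof.
move=> hg; apply: limitM => //; apply: limitM; last exact: limit_in_monomial.
by apply: limitM; [exact: limit_Acoef|exact: limit_out_monomial].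
Qed.

Lemma limit_energy : limit total_energy.
Proof.
apply: laurent_limit_sum => // k _.
apply: laurent_limitD => //; last exact: laurent_limit_cst.
apply: laurent_limitD => //; first exact: (@laurent_limit_coord _ r _ predT k 1).
rewrite (_ : (fun xi => _) = (fun xi => xi k ^ (-1))).
  exact: laurent_limit_coord.
by apply/funext => xi; rewrite exprN1.
Qed.

Lemma integral_combine F G H (a : C) : limit F -> limit G -> limit H ->
  integral F + integral G - a * integral H =
  integral (fun xi => F xi + G xi - a * H xi).
Proof.
move=> hF hG hH.
rewrite -(multi_integralD r_gt0 hF hG) -mulNr addrC.
rewrite -(multi_integral_linear r_gt0 (- a) hH) //; last exact: laurent_limitD.
apply: eq_multi_integral => //.
  by apply: laurent_limitD => //; [apply: limitM => //; exact: laurent_limit_cst|exact: laurent_limitD].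
by move=> xi _; ring.
Qed.

Lemma bethe_function_combine g x1 y1 x2 y2 x3 y3 a : limit g ->
  bethe_function g x1 y1 + bethe_function g x2 y2 - a * bethe_function g x3 y3 =
  \sum_(s : 'S_N) integral (fun xi =>
    bethe_term g s x1 y1 xi + bethe_term g s x2 y2 xi - a * bethe_term g s x3 y3 xi).
Proof.
move=> hg; rewrite /bethe_function mulr_sumr -big_split -sumrB /=.
by apply: eq_bigr => s _; rewrite integral_combine //; exact: limit_term.
Qed.

Lemma limit_combine g s x1 y1 x2 y2 x3 y3 a : limit g ->
  limit (fun xi =>
    bethe_term g s x1 y1 xi + bethe_term g s x2 y2 xi - a * bethe_term g s x3 y3 xi).
Proof.
move=> hg; apply: laurent_limitD => //.
  by apply: laurent_limitD => //; exact: limit_term.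
under eq_fun do rewrite -mulNr.
by apply: limitM; [exact: laurent_limit_cst|exact: limit_term].
Qed.

(** The free part of the Hamiltonian, acting on [x] regardless of collisions,
    multiplies the integrand by the energy. *)
Lemma bethe_function_out g x y : limit g ->
  \sum_i (bethe_function g (step_at x i 1) y + bethe_function g (step_at x i (-1)) y -
          2 * Delta%:C * bethe_function g x y) =
  bethe_function (fun xi => g xi * total_energy xi) x y.
Proof.
move=> hg; have hgE := limitM hg limit_energy.
under eq_bigr do rewrite bethe_function_combine //.
rewrite exchange_big; apply: eq_bigr => s _ /=.
rewrite -(multi_integral_sum r_gt0); last by move=> i; exact: limit_combine.
apply: eq_multi_integral => // [|xi T].
  by apply: laurent_limit_sum => // i _; exact: limit_combine.
rewrite /bethe_term /total_energy [in RHS](reindex_inj (@perm_inj _ s)) /= !mulr_sumr.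
apply: eq_bigr => i _; rewrite !out_monomial_step_at // /energy exprN1 expr1z; ring.
Qed.

(** The energy is invariant under [xi -> 1/xi], so the same holds in [y]. *)
Lemma bethe_function_in g x y : limit g ->
  \sum_i (bethe_function g x (step_at y i 1) + bethe_function g x (step_at y i (-1)) -
          2 * Delta%:C * bethe_function g x y) =
  bethe_function (fun xi => g xi * total_energy xi) x y.
Proof.
move=> hg; have hgE := limitM hg limit_energy.
under eq_bigr do rewrite bethe_function_combine //.
rewrite exchange_big; apply: eq_bigr => s _ /=.
rewrite -(multi_integral_sum r_gt0); last by move=> i; exact: limit_combine.
apply: eq_multi_integral => // [|xi T].
  by apply: laurent_limit_sum => // i _; exact: limit_combine.
rewrite /bethe_term /total_energy !mulr_sumr.
by apply: eq_bigr => i _; rewrite !in_monomial_step_at // /energy opprK exprN1 expr1z; ring.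
Qed.

Lemma antisymmetric_sum0 (K : 'S_N -> C) (h : 'S_N -> 'S_N) : injective h ->
  (forall s, K (h s) = - K s) -> \sum_s K s = 0.
Proof.
move=> hinj hK; have e : \sum_s K s = - \sum_s K s.
  by rewrite [LHS](reindex_inj hinj) -sumrN; apply: eq_bigr => s _; rewrite hK.
have : (\sum_s K s) *+ 2 = 0 by rewrite mulr2n {1}e addNr.
by move/eqP; rewrite mulrn_eq0 => /eqP.
Qed.

Section Boundary.
Variables (i j : 'I_N).
Hypothesis ij : j = i.+1 :> nat.
Let t := tperm i j.

Lemma step_at_tperm x c d : x j + d = x i + c ->
  (fun k => step_at (step_at x i c) j d ((t^-1)%g k)) = step_at (step_at x i c) j d.
Proof.
move=> e; have ne : (i == j) = false.
  by apply/eqP => h; move: ij; rewrite h; lia.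
apply/funext => k; rewrite /t tpermV /step_at.
case: tpermP => [->|->|/eqP ki /eqP kj] //.
  by rewrite !eqxx ne eq_sym ne !addr0 e.
by rewrite !eqxx ne eq_sym ne !addr0 e.
Qed.

(** The three terms combine into a monomial symmetric in [xi_(s i)] and
    [xi_(s j)] times [f(xi_(s j), xi_(s i))], and the terms of [s] and [t * s]
    are opposite. *)
Lemma bethe_boundary_out g x y : limit g -> x j = x i + 1 ->
  bethe_function g (step_at x i 1) y + bethe_function g (step_at x j (-1)) y -
  2 * Delta%:C * bethe_function g x y = 0.
Proof.
move=> hg xij; rewrite bethe_function_combine //.
(* in x' the sites of i and j coincide, so its monomial is symmetric in xi_(s i)
   and xi_(s j) *)
pose x' := step_at (step_at x i 0) j (-1).
have x'E : step_at x j (-1) = x'.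
  by apply/funext => k; rewrite /x' /step_at; case: (k == i); rewrite addr0.
pose T s xi := Acoef Delta s xi * bethe_pair Delta (xi (s j)) (xi (s i)) *
   out_monomial s x' xi * in_monomial y xi * g xi.
have TE s xi : torus r xi ->
    bethe_term g s (step_at x i 1) y xi + bethe_term g s (step_at x j (-1)) y xi -
      2 * Delta%:C * bethe_term g s x y xi = T s xi.
  move=> tx; rewrite /bethe_term /T -x'E !out_monomial_step_at // /bethe_pair exprN1 expr1z.
  by field; exact: torus_neq0 tx.
apply: (antisymmetric_sum0 (h := fun s => (t * s)%g)); first exact: mulgI.
move=> s; rewrite -[RHS]mulN1r -(multi_integralZ r_gt0); last exact: limit_combine.
apply: eq_multi_integral => // [|xi tx]; first exact: limit_combine.
rewrite !TE // /T out_monomial_mul step_at_tperm; last by rewrite addr0 xij addrK.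
rewrite !permM tpermL tpermR (Acoef_tperm_mul hpoles ij s tx).
by rewrite mulN1r !mulNr.
Qed.

(** Here the terms of [s] and [s * t] are opposite only after the integration
    variables [xi_i] and [xi_j] are exchanged. *)
Lemma bethe_boundary_in x y : y j = y i + 1 ->
  bethe_function (fun=> 1) x (step_at y i 1) + bethe_function (fun=> 1) x (step_at y j (-1)) -
  2 * Delta%:C * bethe_function (fun=> 1) x y = 0.
Proof.
move=> yij.
have h1 : limit (fun=> 1) by exact: laurent_limit_cst.
rewrite bethe_function_combine //.
(* in y' the sites of i and j coincide *)
pose y' := step_at (step_at y i 1) j 0.
have y'E : step_at y i 1 = y'.
  by apply/funext => k; rewrite /y' /step_at; case: (k == j); rewrite addr0.
pose T s xi := Acoef Delta s xi * bethe_pair Delta (xi i) (xi j) *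
   out_monomial s x xi * in_monomial y' xi.
have TE s xi : torus r xi ->
    bethe_term (fun=> 1) s x (step_at y i 1) xi + bethe_term (fun=> 1) s x (step_at y j (-1)) xi -
      2 * Delta%:C * bethe_term (fun=> 1) s x y xi = T s xi.
  move=> tx; rewrite /bethe_term /T -y'E !in_monomial_step_at // /bethe_pair opprK exprN1 expr1z.
  by field; exact: torus_neq0 tx.
have hT s : limit (T s).
  apply: (eq_laurent_limit (TE s)); exact: limit_combine.
rewrite (eq_bigr (fun s => integral (T s))) => [|s _]; last first.
  by apply: eq_multi_integral; [exact: r_gt0|exact: limit_combine|exact: TE].
apply: (antisymmetric_sum0 (h := fun s => (s * t)%g)); first exact: mulIg.
move=> s; rewrite -[LHS]opprK; congr (- _).
rewrite -[RHS](multi_integral_relabel r_gt0 t) // -[LHS]mulN1r -(multi_integralZ r_gt0) //.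
apply: eq_multi_integral => // [|xi tx].
  by apply: limitM => //; exact: laurent_limit_cst.
rewrite /T tpermL tpermR (Acoef_mul_tperm hpoles ij s tx).
rewrite in_monomial_relabel step_at_tperm; last by rewrite addr0 yij.
have -> : out_monomial s x (fun k => xi (t k)) = out_monomial (s * t)%g x xi.
  by apply: eq_bigr => k _; rewrite permM.
by rewrite mulN1r !mulNr.
Qed.

End Boundary.

(** [xi_j] occurs with exponent [x (s^-1 j) - y j - 1 <= -2], and [Acoef]
    contributes only nonpositive exponents. *)
Lemma integral_term_eq0 s x y j : x ((s^-1)%g j) < y j ->
  integral (bethe_term (fun=> 1) s x y) = 0.
Proof.
move=> xy.
have h1 : limit (fun=> 1) by exact: laurent_limit_cst.
pose m k := x ((s^-1)%g k) + (- y k - 1).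
rewrite (eq_multi_integral r_gt0 (G := fun xi => Acoef Delta s xi * monomial m xi)).
- apply: (multi_integral_eq0 r_gt0 (j := j)); first exact: laurent_limit_Acoef.
  by rewrite /m; lia.
- exact: limit_term.
move=> xi T; rewrite /bethe_term mulr1 out_monomialE -mulrA; congr (_ * _).
rewrite /monomial -big_split; apply: eq_bigr => k _ /=.
by rewrite /m [RHS]expfzDr // (torus_neq0 r_gt0).
Qed.

Lemma integral_term1 x y :
  integral (bethe_term (fun=> 1) 1 x y) = [forall k, x k == y k]%:R.
Proof.
have h1 : limit (fun=> 1) by exact: laurent_limit_cst.
pose m k := x k + (- y k - 1).
rewrite (eq_multi_integral r_gt0 (G := monomial m)).
- rewrite (multi_integral_monomial r_gt0); congr (_%:R); congr nat_of_bool.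
  by apply: eq_forallb => k; rewrite /m; apply/eqP/eqP; lia.
- exact: limit_term.
move=> xi T; rewrite /bethe_term mulr1 /Acoef big_pred0 ?mul1r => [|p]; last first.
  by rewrite /inversion invg1 !perm1; lia.
rewrite /out_monomial /in_monomial /monomial -big_split; apply: eq_bigr => k _ /=.
by rewrite perm1 /m [RHS]expfzDr // (torus_neq0 r_gt0).
Qed.

End BetheFunction.

(** * Configurations as increasing sequences of sites *)

Section Sites.
Variable N : nat.
Implicit Types (X Y : config N) (i j k : 'I_N).

Let ordered_sites X := sort <=%O (val X : seq int).

Let size_sites X : size (ordered_sites X) = N.
Proof. by rewrite size_sort; apply/eqP; exact: valP X. Qed.

Let sites_sorted X : sorted <%O (ordered_sites X).
Proof. by rewrite sort_lt_sorted; exact: fset_uniq. Qed.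

Let mem_sites X m : (m \in ordered_sites X) = occupied X m.
Proof. by rewrite mem_sort. Qed.

Let sitesE X : ordered_sites X = [seq site X i | i <- enum 'I_N].
Proof.
apply: (@eq_from_nth _ 0) => [|k]; first by rewrite size_map size_enum_ord size_sites.
rewrite size_sites => kN.
by rewrite (nth_map (Ordinal kN)) ?size_enum_ord // /site nth_enum_ord.
Qed.

Lemma site_lt X i j : (site X i < site X j) = (i < j)%N.
Proof.
rewrite /site -/(ordered_sites X) (@lt_sorted_ltn_nth _ _ 0 (ordered_sites X)) //.
- by rewrite inE size_sites.
- by rewrite inE size_sites.
Qed.

Lemma site_inj X : injective (site X).
Proof.
move=> i j e; apply/ord_inj.
by have [h|h|//] := ltngtP i j; move: h; rewrite -(site_lt X) e ltxx.
Qed.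

Lemma occupied_site X i : occupied X (site X i).
Proof. by rewrite -mem_sites mem_nth // size_sites. Qed.

Lemma occupiedP X m : reflect (exists i, site X i = m) (occupied X m).
Proof.
apply: (iffP idP) => [|[i <-]]; last exact: occupied_site.
by rewrite -mem_sites sitesE => /mapP[i _ ->]; exists i.
Qed.

Lemma sum_sites (V : nmodType) X (F : int -> V) :
  \sum_(m <- val X) F m = \sum_i F (site X i).
Proof.
have -> : \sum_(m <- val X) F m = \sum_(m <- ordered_sites X) F m.
  by apply: perm_big; rewrite perm_sym perm_sort.
by rewrite sitesE big_map big_enum.
Qed.

Lemma config_eq X Y : (forall i, site X i = site Y i) -> X = Y.
Proof.
move=> e; apply/val_inj/fsetP => m.
by apply/(occupiedP X m)/(occupiedP Y m) => -[i <-]; exists i; rewrite e.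
Qed.

(** Two strictly increasing enumerations of the same set agree. *)
Lemma site_unique X (g : 'I_N -> int) : (forall i j, (i < j)%N -> g i < g j) ->
  (forall i, occupied X (g i)) -> forall i, site X i = g i.
Proof.
move=> gmono gocc.
have ginj : injective g.
  move=> i j e; apply/ord_inj.
  by have [h|h|//] := ltngtP i j; move/gmono: h; rewrite e ltxx.
have e : ordered_sites X = [seq g i | i <- enum 'I_N].
  have gs : sorted <%O [seq g i | i <- enum 'I_N].
    rewrite sorted_map; apply: (@sub_sorted _ (relpre val ltn)) => [i j|].
      exact: gmono.
    by rewrite -sorted_map val_enum_ord iota_ltn_sorted.
  apply: lt_sorted_eq => // m.
  have sub : {subset [seq g i | i <- enum 'I_N] <= ordered_sites X}.
    by move=> _ /mapP[i _ ->]; rewrite mem_sites.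
  have [||_ ->//] := uniq_min_size (s1 := [seq g i | i <- enum 'I_N]) _ sub.
    by rewrite map_inj_uniq ?enum_uniq.
  by rewrite size_map size_enum_ord size_sites.
move=> i; have := sitesE X; rewrite e => /eq_in_map ->//.
by rewrite mem_enum.
Qed.

(** [true] is a step to the right, [false] a step to the left. *)
Definition direction (b : bool) : int := if b then 1 else -1.

Definition can_move b i X : bool := ~~ occupied X (site X i + direction b).

Definition move b i X : config N :=
  exchange (if b then site X i else site X i - 1) X.

Lemma site_move b i X : can_move b i X ->
  forall k, site (move b i X) k = step_at (site X) i (direction b) k.
Proof.
move=> free; have xfree k : site X k != site X i + direction b.
  by apply: contra free => /eqP <-; exact: occupied_site.
apply: site_unique => [k l kl|k].
  move: kl (xfree k) (xfree l); rewrite -(site_lt X) /step_at.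
  case: (eqVneq k i) => [->|ki]; case: (eqVneq l i) => [->|li];
    by rewrite /direction; case: b {free xfree} => /=; lia.
rewrite /move occupied_exchange /step_at /swap_int.
case: (eqVneq k i) => [->|ki].
  rewrite /direction; case: b {free xfree}.
    by rewrite ifF ?eqxx ?occupied_site //; apply/eqP; lia.
  by rewrite eqxx subrK occupied_site.
have nki : site X k != site X i by apply: contra ki => /eqP/site_inj ->.
have := xfree k; rewrite addr0 /direction; case: b {free xfree} => nk.
  by rewrite (negPf nki) (negPf nk) occupied_site.
by rewrite subrK (negPf nk) (negPf nki) occupied_site.
Qed.

Lemma site_adjacent X i j : j = i.+1 :> nat ->
  (~~ can_move true i X = (site X j == site X i + 1)) /\
  (~~ can_move false j X = (site X j == site X i + 1)).
Proof.
move=> ij; have ltij : site X i < site X j by rewrite site_lt ij.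
rewrite /can_move !negbK; split.
  apply/idP/eqP => [/occupiedP[k hk]|<-]; last exact: occupied_site.
  have lik : (i < k)%N by rewrite -(site_lt X) hk /direction; lia.
  have [jk|kj|/ord_inj -> //] := ltngtP j k; last by lia.
  by move: jk; rewrite -(site_lt X) hk /direction; lia.
apply/idP/eqP => [/occupiedP[k hk]|e]; last first.
  by rewrite e addrK occupied_site.
have lkj : (k < j)%N by rewrite -(site_lt X) hk /direction; lia.
have [ik|ki|/ord_inj ik] := ltngtP i k; first by lia.
  by move: ki; rewrite -(site_lt X) hk /direction; lia.
by move: hk; rewrite -ik => ->; rewrite /direction subrK.
Qed.

Lemma can_move_last X i : i = N.-1 :> nat -> can_move true i X.
Proof.
move=> iN; apply/negP => /occupiedP[k hk].
have : (i < k)%N by rewrite -(site_lt X) hk /direction; lia.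
by have := ltn_ord k; lia.
Qed.

Lemma can_move_first X i : i = 0 :> nat -> can_move false i X.
Proof.
move=> i0; apply/negP => /occupiedP[k hk].
have : (k < i)%N by rewrite -(site_lt X) hk /direction; lia.
by rewrite i0.
Qed.

End Sites.

(** * The Hamiltonian in terms of moves of single particles *)

Section MoveHamiltonian.
Variables (R : realType) (N : nat) (Delta : R).
Local Notation C := R[i].
Implicit Types (X Y : config N) (psi : config N -> C).

(** A bond with exactly one occupied end is the bond across which one particle can
    move, to the right if the left end is occupied and to the left otherwise. *)
Lemma HxxzE psi X : Hxxz Delta psi X =
  \sum_(b : bool) \sum_(i | can_move b i X) (- Delta%:C * psi X + psi (move b i X)).
Proof.
pose G j := - Delta%:C * psi X + psi (exchange j X).
pose A := (val X `|` [fset m - 1 | m in val X])%fset.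
rewrite /Hxxz (@fsbigTE _ _ _ _ A) => [|j]; last first.
  rewrite inE negb_or => /andP[jX jX1]; rewrite bondE.
  rewrite /occupied (negPf jX); case: ifP => // /negbFE j1.
  by case/negP: jX1; apply/imfsetP; exists (j + 1) => //; rewrite addrK.
have splitG j : bond Delta j psi X =
    (if occupied X j && ~~ occupied X (j + 1) then G j else 0) +
    (if ~~ occupied X j && occupied X (j + 1) then G j else 0).
  by rewrite bondE; case: (occupied X j); case: (occupied X (j + 1)); rewrite /= ?addr0 ?add0r.
rewrite (eq_bigr _ (fun j _ => splitG j)) big_split big_bool /=; congr (_ + _).
  rewrite -(@big_fset_incl _ _ _ _ (val X)) => [||j _ jX].
  - rewrite sum_sites [RHS]big_mkcond; apply: eq_bigr => i _.
    by rewrite occupied_site.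
  - exact: fsubsetUl.
  - by rewrite /occupied (negPf jX).
rewrite -(@big_fset_incl _ _ _ _ [fset m - 1 | m in val X]%fset) => [||j _ jX].
- rewrite big_imfset /=; last by move=> m m' _ _ /addIr.
  rewrite sum_sites [RHS]big_mkcond; apply: eq_bigr => i _.
  by rewrite subrK occupied_site andbT.
- exact: fsubsetUr.
case: ifP => // /andP[_ j1]; case/negP: jX; apply/imfsetP.
by exists (j + 1) => //; rewrite addrK.
Qed.

(** The matrix of the Hamiltonian is symmetric. *)
Lemma Hxxz_delta X Y :
  Hxxz Delta (fun Z => (Z == Y)%:R) X = Hxxz Delta (fun Z => (X == Z)%:R) Y.
Proof.
rewrite /Hxxz; apply: eq_fsbigr => j _; rewrite !bondE.
have sw1 : swap_int j j = j + 1 by rewrite /swap_int eqxx.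
have sw2 : swap_int j (j + 1) = j by rewrite -[RHS](swap_intK j) sw1.
have exE : (exchange j X == Y) = (X == exchange j Y).
  by apply/eqP/eqP => [<-|->]; rewrite exchangeK.
case: (eqVneq X Y) => [->|XY]; first by rewrite [Y == _]eq_sym.
transitivity (if occupied X j == occupied X (j + 1) then 0
  else - Delta%:C * false%:R + (X == exchange j Y)%:R).
  by congr (if _ then _ else _ + (nat_of_bool _)%:R); exact: exE.
case: (eqVneq X (exchange j Y)) => [->|XeY].
  by rewrite !occupied_exchange sw1 sw2 [occupied Y (j + 1) == _]eq_sym.
by rewrite mulr0 addr0 !if_same.
Qed.

End MoveHamiltonian.

(** The right hand side also contains the forbidden moves: the [i]-th particle to
    the right and the [i.+1]-st to the left when they are adjacent.  Together
    they contribute the left hand side of the boundary relation. *)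
Lemma Hxxz_extend (R : realType) (n : nat) (Delta : R)
    (Phi : ('I_n.+1 -> int) -> R[i]) (X : config n.+1) :
  (forall i j : 'I_n.+1, j = i.+1 :> nat -> site X j = site X i + 1 ->
     Phi (step_at (site X) i 1) + Phi (step_at (site X) j (-1)) -
       2 * Delta%:C * Phi (site X) = 0) ->
  Hxxz Delta (fun Z => Phi (site Z)) X =
  \sum_i (Phi (step_at (site X) i 1) + Phi (step_at (site X) i (-1)) -
          2 * Delta%:C * Phi (site X)).
Proof.
move=> hPhi; rewrite HxxzE.
pose K b i := - Delta%:C * Phi (site X) + Phi (step_at (site X) i (direction b)).
have -> : \sum_(b : bool) \sum_(i | can_move b i X)
    (- Delta%:C * Phi (site X) + Phi (site (move b i X))) =
    \sum_(b : bool) \sum_(i | can_move b i X) K b i.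
  apply: eq_bigr => b _; apply: eq_bigr => i hi; congr (_ + Phi _).
  by apply/funext => k; exact: site_move.
have -> : \sum_i (Phi (step_at (site X) i 1) + Phi (step_at (site X) i (-1)) -
    2 * Delta%:C * Phi (site X)) = \sum_i K true i + \sum_i K false i.
  by rewrite -big_split; apply: eq_bigr => i _ /=; rewrite /K /direction; ring.
rewrite big_bool /= [in RHS](bigID (fun i => can_move true i X)) /=.
rewrite [X in _ = _ + X](bigID (fun i => can_move false i X)) /=.
rewrite addrACA -[LHS]addr0; congr (_ + _).
rewrite big_mkcond big_ord_recr /= can_move_last // addr0.
rewrite [X in _ = _ + X]big_mkcond big_ord_recl /= can_move_first // add0r.
rewrite -big_split /= big1 // => i _.
have [e1 e2] := @site_adjacent _ X (widen_ord (leqnSn n) i) (lift ord0 i) erefl.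
rewrite e1 e2; case: eqP => [e|_]; last by rewrite addr0.
by rewrite -(hPhi _ _ _ e) // /K /direction; ring.
Qed.

Section HamiltonianLinear.
Variables (R : realType) (N : nat) (Delta : R).
Local Notation C := R[i].

Lemma Hxxz_linear (a : C) (u v : config N -> C) :
  Hxxz Delta (fun X => a * u X + v X) =
  fun X => a * Hxxz Delta u X + Hxxz Delta v X.
Proof.
apply/funext => X; rewrite !HxxzE mulr_sumr -big_split; apply: eq_bigr => b _ /=.
rewrite mulr_sumr -big_split; apply: eq_bigr => i _ /=; ring.
Qed.

End HamiltonianLinear.

Lemma perm_mono_id n (s : 'S_n) :
  (forall i j : 'I_n, (i < j)%N -> (s i < s j)%N) -> s = 1%g.
Proof.
move=> smono; apply/permP => i; rewrite perm1; apply/ord_inj.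
suff e : [seq val (s k) | k <- enum 'I_n] = [seq val k | k <- enum 'I_n].
  by have /eq_in_map := e; apply; rewrite mem_enum.
apply: (irr_sorted_eq ltn_trans ltnn) => [||m].
- rewrite sorted_map; apply: (@sub_sorted _ (relpre val ltn)) => [k l|].
    exact: smono.
  by rewrite -sorted_map val_enum_ord iota_ltn_sorted.
- by rewrite val_enum_ord iota_ltn_sorted.
apply/mapP/mapP => -[k _ ->].
  by exists (s k); rewrite ?mem_enum.
by exists ((s^-1)%g k); rewrite ?mem_enum ?permKV.
Qed.

(** * The initial condition *)

Section InitialCondition.
Variables (R : realType) (n : nat) (Delta r : R).
Hypothesis r_gt0 : 0 < r.
Hypothesis hpoles : poles_inside n.+1 Delta r.
Local Notation C := R[i].
Local Notation N := n.+1.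
Implicit Types (X Y : config N) (i j k : 'I_N).

Definition kernel_defect X Y : C :=
  bethe_function Delta r (fun=> 1) (site X) (site Y) - (X == Y)%:R.

(** Both sides insert the energy into the integrand; the identity kernel commutes
    with the Hamiltonian as well. *)
Lemma kernel_defect_commute X Y :
  Hxxz Delta (fun Z => kernel_defect Z Y) X = Hxxz Delta (fun Z => kernel_defect X Z) Y.
Proof.
have h1 : laurent_limit r (@predT ('I_N -> int)) (fun=> 1) by exact: laurent_limit_cst.
pose Phi := bethe_function Delta r (fun=> 1 : C) : ('I_N -> int) -> ('I_N -> int) -> C.
have e1 : (fun Z => kernel_defect Z Y) = fun Z => (-1) * (Z == Y)%:R + Phi (site Z) (site Y).
  by apply/funext => Z; rewrite /kernel_defect mulN1r addrC.
have e2 : (fun Z => kernel_defect X Z) = fun Z => (-1) * (X == Z)%:R + Phi (site X) (site Z).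
  by apply/funext => Z; rewrite /kernel_defect mulN1r addrC.
rewrite e1 e2 !Hxxz_linear Hxxz_delta; congr (_ + _).
rewrite (Hxxz_extend (Phi := Phi ^~ (site Y))); last first.
  by move=> i j ij xij; apply: (bethe_boundary_out r_gt0 hpoles ij).
rewrite (Hxxz_extend (Phi := Phi (site X))); last first.
  by move=> i j ij xij; apply: (bethe_boundary_in r_gt0 hpoles ij).
by rewrite (bethe_function_out r_gt0 hpoles) // (bethe_function_in r_gt0 hpoles).
Qed.

Definition degree X : int := \sum_i site X i.

Lemma degree_move b i X : can_move b i X -> degree (move b i X) = degree X + direction b.
Proof.
move=> hb; rewrite /degree (eq_bigr _ (fun k _ => site_move hb k)) /step_at big_split /=.
by rewrite -big_mkcond big_pred1_eq.
Qed.

Lemma kernel_defect_eq0 X Y :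
  (forall s : 'S_N, (forall i, site Y (s i) <= site X i) -> s = 1%g) ->
  kernel_defect X Y = 0.
Proof.
move=> hs; rewrite /kernel_defect.
have -> : bethe_function Delta r (fun=> 1) (site X) (site Y) =
    multi_circle_integral r (bethe_term Delta (fun=> 1) (1 : 'S_N)%g (site X) (site Y)).
  rewrite /bethe_function (bigD1 (1 : 'S_N)%g) // big1 => [|s s1]; first exact: addr0.
  have [i hi] : exists i, site X i < site Y (s i).
    apply: contrapT => /forallNP h; case/eqP: s1; apply: hs => i.
    by rewrite leNgt; apply/negP/h.
  by apply: (integral_term_eq0 r_gt0 hpoles (j := s i)); rewrite permK.
rewrite (integral_term1 r_gt0 hpoles).
rewrite (_ : [forall k, site X k == site Y k] = (X == Y)) ?subrr //.
apply/forallP/eqP => [h|-> //]; apply: config_eq => k; exact/eqP.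
Qed.

Lemma degree_perm X Y (s : 'S_N) : \sum_i (site X i - site Y (s i)) = degree X - degree Y.
Proof. by rewrite sumrB; congr (_ - _); rewrite /degree [RHS](reindex_inj (@perm_inj _ s)). Qed.

Lemma kernel_defect_neg X Y : degree X - degree Y < 0 -> kernel_defect X Y = 0.
Proof.
move=> dneg; apply: kernel_defect_eq0 => s hs.
move: dneg; rewrite -(degree_perm X Y s) ltNge sumr_ge0 // => i _.
by rewrite subr_ge0.
Qed.

(** If the term of [s] survives, then [site Y (s i)] lies between [site X i - d]
    and [site X i], since the differences are nonnegative and add up to [d]; as
    the gaps of [X] exceed [d], [s] is increasing. *)
Lemma kernel_defect_gaps (d : nat) X Y : degree X - degree Y = d ->
  (forall i j, j = i.+1 :> nat -> d%:Z < site X j - site X i) -> kernel_defect X Y = 0.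
Proof.
move=> dXY gaps; apply: kernel_defect_eq0 => s hs.
have ub i : site X i - site Y (s i) <= d.
  rewrite -dXY -(degree_perm X Y s) (bigD1 i) //= lerDl; apply: sumr_ge0 => k _.
  by rewrite subr_ge0.
apply: perm_mono_id => i j ij; rewrite -(site_lt Y).
have iN : (i.+1 < N)%N by rewrite (leq_ltn_trans ij).
have g := gaps i (Ordinal iN) erefl.
have le : site X (Ordinal iN) <= site X j by rewrite leNgt site_lt -leqNgt.
by have := ub j; have := hs i; lia.
Qed.

(** The requirement of large gaps is removed from one gap, the [m]-th with
    [m + k.+1 = n].  The inner induction is on a bound [e] for the shortfall of
    this gap; each step costs at most 2 in the gaps to its left, which are
    therefore required to exceed [c + 2 e]. *)
Lemma kernel_defect_step (d k : nat) :
  (forall X Y, degree X - degree Y < d -> kernel_defect X Y = 0) ->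
  (exists c : nat, forall X Y, degree X - degree Y = d ->
     (forall i j, j = i.+1 :> nat -> (i + k < n)%N -> c%:Z < site X j - site X i) ->
     kernel_defect X Y = 0) ->
  (exists c : nat, forall X Y, degree X - degree Y = d ->
     (forall i j, j = i.+1 :> nat -> (i + k.+1 < n)%N -> c%:Z < site X j - site X i) ->
     kernel_defect X Y = 0).
Proof.
move=> IHd [c hc]; have [kn|nk] := ltnP k n; last first.
  by exists c => X Y dXY _; apply: hc => // i j _; lia.
(* the gap between the particles m and m.+1 is the one to be enlarged *)
pose m := (n.-1 - k)%N.
have mN : (m < N)%N by rewrite /m; lia.
have m1N : (m.+1 < N)%N by rewrite /m; lia.
pose im := Ordinal mN; pose jm := Ordinal m1N.
suff inner e : forall X Y, degree X - degree Y = d ->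
    (forall i j, j = i.+1 :> nat -> (i < m)%N -> (c + 2 * e)%N%:Z < site X j - site X i) ->
    c%:Z < site X jm - site X im + e%:Z -> kernel_defect X Y = 0.
  exists (3 * c)%N => X Y dXY gaps; apply: (inner c) => // [i j ij im'|].
    have := gaps i j ij; rewrite (_ : (i + k.+1 < n)%N); last by rewrite /m in im'; lia.
    by move=> /(_ isT); lia.
  have lt_m : site X im < site X jm by rewrite site_lt /=.
  by lia.
have big_gap X Y : degree X - degree Y = d ->
    (forall i j, j = i.+1 :> nat -> (i < m)%N -> c%:Z < site X j - site X i) ->
    c%:Z < site X jm - site X im -> kernel_defect X Y = 0.
  move=> dXY gaps gm; apply: hc => // i j ij ik.
  have [im'|mi] := ltnP i m; first exact: gaps.
  have -> : i = im by apply/ord_inj => /=; rewrite /m in mi *; lia.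
  have -> : j = jm by apply/ord_inj => /=; rewrite /m in mi *; lia.
  exact: gm.
elim: e => [|e IHe] X Y dXY gaps gm.
  by apply: big_gap => // [i j ij im'|]; [have := gaps i j ij im'|]; lia.
have [gm'|gm'] := ltP c%:Z (site X jm - site X im).
  by apply: big_gap => // i j ij im'; have := gaps i j ij im'; lia.
(* the particle m can move left: the gap to its left is greater than 1 *)
have free : can_move false im X.
  have [m0|m0] := posnP m; first exact: can_move_first.
  have m1 : (m.-1 < N)%N by lia.
  have adj : im = (Ordinal m1).+1 :> nat by rewrite /= prednK.
  have := gaps (Ordinal m1) im adj; rewrite /= => /(_ _)/wrap[]; first by lia.
  rewrite -[can_move _ _ _]negbK (site_adjacent X adj).2 => h; apply/eqP => h'.
  by move: h; rewrite h'; lia.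
pose X0 := move false im X.
have s0 l : site X0 l = step_at (site X) im (-1) l := site_move free l.
have d0 : degree X0 = degree X - 1 := degree_move free.
have ne : (jm == im) = false by apply/negP => /eqP/(congr1 (@nat_of_ord N)) /=; lia.
have z0 : kernel_defect X0 Y = 0 by apply: IHd; rewrite d0; lia.
(* at (X0, Y) the moves of X0 to the left and of Y to the right lower the
   difference of degrees to d - 2; the other moves keep it equal to d, and leave a
   larger m-th gap unless the particle m moves back *)
have := kernel_defect_commute X0 Y; rewrite !HxxzE !big_bool /= z0 mulr0.
have s0b l : site X l - 1 <= site X0 l <= site X l.
  by rewrite s0 /step_at; case: ifP => _; lia.
have s0i : site X0 im = site X im - 1 by rewrite s0 /step_at eqxx.
have s0j : site X0 jm = site X jm by rewrite s0 /step_at ne addr0.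
rewrite [X in _ + X = _]big1 => [|i hi]; last first.
  by rewrite add0r; apply: IHd; rewrite (degree_move hi) d0 /direction; lia.
rewrite [X in _ = X + _]big1 => [|i hi]; last first.
  by rewrite add0r; apply: IHd; rewrite (degree_move hi) d0 /direction; lia.
rewrite [X in _ = _ + X]big1 => [|i hi]; last first.
  rewrite add0r; apply: IHe; first by rewrite (degree_move hi) d0 /direction; lia.
    by move=> i' j' ij' im'; have := gaps i' j' ij' im'; have := s0b i'; have := s0b j'; lia.
  by rewrite s0i s0j; lia.
have free' : can_move true im X0.
  apply/negP => /occupiedP[l]; rewrite s0i /direction subrK s0 /step_at.
  by case: eqP => [->|ln]; [lia|rewrite addr0 => /site_inj].
rewrite (bigD1 im) //= big1 => [|i /andP[hi ni]]; last first.
  rewrite add0r; have s1 l : site (move true i X0) l = step_at (site X0) i 1 l := site_move hi l.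
  have s1b l : site X0 l <= site (move true i X0) l <= site X0 l + 1.
    by rewrite s1 /step_at; case: ifP => _; lia.
  apply: IHe; first by rewrite (degree_move hi) d0 /direction; lia.
    move=> i' j' ij' im'; have := gaps i' j' ij' im'.
    by have := s0b i'; have := s0b j'; have := s1b i'; have := s1b j'; lia.
  have : site (move true i X0) im = site X0 im.
    by rewrite s1 /step_at eq_sym (negPf ni) addr0.
  by have := s1b jm; rewrite s0i s0j; lia.
rewrite !addr0 add0r; have -> // : move true im X0 = X.
apply: config_eq => l; rewrite (site_move free') /step_at s0 /step_at /direction.
by case: ifP => _; lia.
Qed.

Lemma kernel_defect0 X Y : kernel_defect X Y = 0.
Proof.
have [|dpos] := ltP (degree X - degree Y) 0; first exact: kernel_defect_neg.
(* induction on the difference of degrees, then removal of the gap conditions one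
   by one *)
have [d dE] : exists d : nat, degree X - degree Y = d.
  by exists `|degree X - degree Y|%N; lia.
elim/ltn_ind: d X Y dE {dpos} => d IHd X Y dXY.
have IH Z W : degree Z - degree W < d -> kernel_defect Z W = 0.
  move=> dZW; have [|dpos] := ltP (degree Z - degree W) 0; first exact: kernel_defect_neg.
  by apply: (IHd `|degree Z - degree W|%N); lia.
have gapped (k : nat) : exists c : nat, forall X Y, degree X - degree Y = d ->
   (forall i j, j = i.+1 :> nat -> (i + k < n)%N -> c%:Z < site X j - site X i) ->
   kernel_defect X Y = 0.
  elim: k => [|k IHk]; last exact: kernel_defect_step.
  exists d => Z W dZW gaps; apply: kernel_defect_gaps dZW _ => i j ij.
  by apply: gaps => //; have := ltn_ord j; lia.
have [c hc] := gapped n.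
by apply: hc => // i j _; lia.
Qed.

Lemma bethe_initial X Y :
  bethe_function Delta r (fun=> 1) (site X) (site Y) = (X == Y)%:R.
Proof. by apply/eqP; rewrite -subr_eq0; apply/eqP; exact: kernel_defect0. Qed.

End InitialCondition.

(** * Norm bounds for the Hamiltonian *)

Section HamiltonianNorms.
Variables (R : realType) (N : nat) (Delta : R).
Local Notation C := R[i].
Local Notation H := (@Hxxz R N Delta).
Implicit Types (X : config N) (v : config N -> C).

(** A configuration has at most [2 N] moves. *)
Definition Hnorm : R := (2 * N)%:R * (`|Delta| + 1).

Lemma sum_moves_const (K : R) : \sum_(b : bool) \sum_(i < N) K = (2 * N)%:R * K.
Proof.
by rewrite big_bool /= !sumr_const card_ord mul2n -addnn natrD mulrDl !mulr_natl.
Qed.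

Lemma normc_Hxxz v X : normc (H v X) <=
  \sum_(b : bool) \sum_(i | can_move b i X) (`|Delta| * normc (v X) + normc (v (move b i X))).
Proof.
rewrite HxxzE (le_trans (normc_sum _ _ _)) //; apply: ler_sum => b _.
rewrite (le_trans (normc_sum _ _ _)) //; apply: ler_sum => i _.
rewrite (le_trans (ler_normcD _ _)) // ComplexField.Normc.normcM normc_opp normc_real.
exact: lexx.
Qed.

Lemma Hxxz_sup_bound v M : (forall X, normc (v X) <= M) ->
  forall X, normc (H v X) <= Hnorm * M.
Proof.
move=> hv X; rewrite (le_trans (normc_Hxxz _ _)) //.
have M0 : 0 <= M by rewrite (le_trans (normc_ge0 (v X))).
rewrite /Hnorm -mulrA -sum_moves_const; apply: ler_sum => b _.
rewrite big_mkcond; apply: ler_sum => i _; case: ifP => _.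
  by rewrite mulrDl mul1r lerD ?ler_wpM2l.
by rewrite mulr_ge0 ?addr_ge0.
Qed.

(** The l^1 norm is at most [B], stated on finite sets of configurations, so that
    it passes to pointwise limits ([l1_le_limit]). *)
Definition l1_le v (B : R) : Prop :=
  forall s : seq (config N), uniq s -> \sum_(X <- s) normc (v X) <= B.

Lemma l1_le_ge0 v B : l1_le v B -> 0 <= B.
Proof. by move=> /(_ [::] isT); rewrite big_nil. Qed.

Lemma l1_leW v B B' : B <= B' -> l1_le v B -> l1_le v B'.
Proof. by move=> BB h s us; rewrite (le_trans (h s us)). Qed.

Lemma l1_leZ (a : C) v B : l1_le v B -> l1_le (fun X => a * v X) (normc a * B).
Proof.
move=> hv s us; under eq_bigr do rewrite ComplexField.Normc.normcM.
by rewrite -mulr_sumr ler_wpM2l ?normc_ge0 ?hv.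
Qed.

Lemma l1_le_sum n (v : 'I_n -> config N -> C) (B : 'I_n -> R) :
  (forall k, l1_le (v k) (B k)) ->
  l1_le (fun X => \sum_k v k X) (\sum_k B k).
Proof.
move=> hv s us; apply: (@le_trans _ _ (\sum_k \sum_(X <- s) normc (v k X))).
  by rewrite exchange_big; apply: ler_sum => X _; exact: normc_sum.
by apply: ler_sum => k _; exact: hv.
Qed.

Lemma move_inj b i X Y : can_move b i X -> can_move b i Y ->
  move b i X = move b i Y -> X = Y.
Proof.
move=> hX hY e; apply: config_eq => k.
have := site_move hX k; have := site_move hY k; rewrite e => -> /eqP.
by rewrite /step_at (inj_eq (addIr _)) => /eqP.
Qed.

Lemma l1_le_move v B b i s : l1_le v B -> uniq s ->
  \sum_(X <- s | can_move b i X) normc (v (move b i X)) <= B.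
Proof.
move=> hv us; rewrite -big_filter -(big_map (move b i) predT (fun X => normc (v X))).
apply: hv; rewrite map_inj_in_uniq ?filter_uniq // => X Y.
by rewrite !mem_filter => /andP[hX _] /andP[hY _]; exact: move_inj.
Qed.

(** For fixed [b] and [i] a move is injective where it is allowed, so that summing
    over its images does not exceed the norm of [v]. *)
Lemma l1_le_H v B : l1_le v B -> l1_le (H v) (Hnorm * B).
Proof.
move=> hv s us.
apply: (@le_trans _ _ (\sum_(b : bool) \sum_(i < N) \sum_(X <- s | can_move b i X)
    (`|Delta| * normc (v X) + normc (v (move b i X))))).
  under [leRHS]eq_bigr do under eq_bigr do rewrite big_mkcond.
  rewrite [leRHS]big_bool /= [X in _ <= X + _]exchange_big [X in _ <= _ + X]exchange_big /=.
  rewrite -big_split; apply: ler_sum => X _; rewrite (le_trans (normc_Hxxz _ _)) //.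
  by rewrite big_bool /= -!big_mkcond.
rewrite /Hnorm -mulrA -sum_moves_const; apply: ler_sum => b _; apply: ler_sum => i _.
rewrite mulrDl mul1r big_split lerD //; last exact: l1_le_move.
rewrite -mulr_sumr ler_wpM2l // (le_trans _ (hv s us)) //.
by rewrite big_mkcond; apply: ler_sum => X _; case: ifP => _; rewrite ?normc_ge0.
Qed.

Lemma l1_le_iter v B k : l1_le v B -> l1_le (iter k H v) (Hnorm ^+ k * B).
Proof.
move=> hv; elim: k => [|k IHk]; first by rewrite expr0 mul1r.
by rewrite iterS exprS -mulrA; exact: l1_le_H.
Qed.

Definition pointwise_limit (P : nat -> config N -> C) (f : config N -> C) : Prop :=
  forall X e, 0 < e -> exists n0, forall n, (n0 <= n)%N -> normc (f X - P n X) <= e.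

Lemma pointwise_limit_unique P f g :
  pointwise_limit P f -> pointwise_limit P g -> forall X, f X = g X.
Proof.
move=> hf hg X; apply/eqP; rewrite -subr_eq0; apply/eqP.
apply: (@normc_le_eps _ _ 2) => e e0.
have [n1 h1] := hf X e e0; have [n2 h2] := hg X e e0.
have -> : f X - g X = (f X - P (maxn n1 n2) X) - (g X - P (maxn n1 n2) X) by ring.
rewrite (le_trans (ler_normcB _ _)) // mulr_natl mulr2n lerD //.
  by rewrite h1 // leq_maxl.
by rewrite h2 // leq_maxr.
Qed.

Lemma l1_le_limit P f B : pointwise_limit P f -> (forall n, l1_le (P n) B) -> l1_le f B.
Proof.
move=> hf hP s us; apply/ler_addgt0Pl => e e0.
(* the tolerance is shared between the elements of s *)
pose d := e / ((size s)%:R + 1).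
have s1 : 0 < (size s)%:R + 1 :> R by rewrite ltr_wpDl.
have d0 : 0 < d by rewrite divr_gt0.
have tail (s' : seq (config N)) : exists n0, forall n, (n0 <= n)%N ->
    \sum_(X <- s') normc (f X - P n X) <= (size s')%:R * d.
  elim: s' => [|X s' [n1 h1]]; first by exists 0 => n _; rewrite big_nil mul0r.
  have [n2 h2] := hf X d d0; exists (maxn n1 n2) => n; rewrite geq_max => /andP[l1 l2].
  by rewrite big_cons /= -nat1r mulrDl mul1r lerD ?h1 ?h2.
have [n hn] := tail s.
apply: (@le_trans _ _ (\sum_(X <- s) normc (f X - P n X) + \sum_(X <- s) normc (P n X))).
  rewrite -big_split; apply: ler_sum => X _.
  by rewrite -[f X in leLHS](subrK (P n X)) ler_normcD.
rewrite addrC [leRHS]addrC lerD ?hP // (le_trans (hn n (leqnn n))) // /d.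
by rewrite mulrCA -[leRHS]mulr1 ler_wpM2l ?(ltW e0) // ler_pdivrMr // mul1r lerDl.
Qed.

Section TaylorBounds.
Variables (kappa : C) (v : config N -> C) (B h : R).
Hypothesis kappa1 : normc kappa <= 1.
Hypothesis hv : l1_le v B.

Let Hnorm_ge0 : 0 <= Hnorm.
Proof. by rewrite mulr_ge0 ?addr_ge0. Qed.

Let term_le k : l1_le (fun X => (divided_power k h)%:C * (kappa ^+ k * iter k H v X))
  (divided_power k (Hnorm * `|h|) * B).
Proof.
have := l1_leZ ((divided_power k h)%:C * kappa ^+ k) (l1_le_iter k hv).
under eq_fun do rewrite -mulrA; apply: l1_leW.
rewrite ComplexField.Normc.normcM normc_real normcX /divided_power normrM normfV normr_nat normrX.
have B0 := l1_le_ge0 hv; rewrite mulrA ler_wpM2r //.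
have k1 : normc kappa ^+ k <= 1 by rewrite exprn_ile1 ?normc_ge0.
apply: (@le_trans _ _ (`|h| ^+ k / k`!%:R * 1 * Hnorm ^+ k)); last first.
  by rewrite mulr1 [(Hnorm * _) ^+ k]exprMn [leLHS]mulrC mulrA.
by rewrite ler_wpM2r ?exprn_ge0 // ler_wpM2l // divr_ge0 ?exprn_ge0.
Qed.

Lemma l1_le_taylor n : l1_le (taylor H kappa v n h) (expR (Hnorm * `|h|) * B).
Proof.
apply: (l1_leW (B := (\sum_(k < n) divided_power k (Hnorm * `|h|)) * B)).
  rewrite ler_wpM2r ?(l1_le_ge0 hv) // sum_divided_power_le // mulr_ge0 //.
by rewrite mulr_suml; apply: l1_le_sum => k; exact: term_le.
Qed.

(** The terms of order at least 2, with [x^(k+2)/(k+2)! <= x^2 x^k/k!]. *)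
Lemma l1_le_taylor2 n :
  l1_le (fun X => taylor H kappa v n.+2 h X - (v X + h%:C * (kappa * H v X)))
    (h ^+ 2 * (Hnorm ^+ 2 * expR (Hnorm * `|h|) * B)).
Proof.
have -> : (fun X => taylor H kappa v n.+2 h X - (v X + h%:C * (kappa * H v X))) =
    fun X => \sum_(k < n) (divided_power k.+2 h)%:C * (kappa ^+ k.+2 * iter k.+2 H v X).
  apply/funext => X; rewrite /taylor !big_ord_recl /= divided_power0 expr0 !mul1r.
  have d1 : divided_power 1 h = h by rewrite /divided_power expr1 divr1.
  rewrite -[bump 0 0]/1%N d1 expr1 addrA [X in X - _]addrC addrK.
  exact: eq_bigr.
apply: (l1_leW (B := \sum_(k < n) divided_power k.+2 (Hnorm * `|h|) * B)); last first.
  by apply: l1_le_sum => k; exact: term_le.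
have h0 : 0 <= Hnorm * `|h| by rewrite mulr_ge0.
rewrite -mulr_suml [leRHS]mulrA ler_wpM2r ?(l1_le_ge0 hv) //.
apply: (@le_trans _ _ ((Hnorm * `|h|) ^+ 2 * \sum_(k < n) divided_power k (Hnorm * `|h|))).
  rewrite mulr_sumr; apply: ler_sum => k _; rewrite /divided_power.
  rewrite -addn2 addnC exprD -mulrA ler_wpM2l ?exprn_ge0 // ler_wpM2l ?exprn_ge0 //.
  rewrite lef_pV2 ?posrE ?ltr0n ?fact_gt0 // ler_nat.
  by apply: leq_fact; rewrite leq_addl.
rewrite [(Hnorm * _) ^+ 2]exprMn real_normK ?num_real // [leRHS]mulrA [h ^+ 2 * _]mulrC.
by rewrite ler_wpM2l ?sum_divided_power_le // mulr_ge0 ?exprn_even_ge0.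
Qed.

End TaylorBounds.

Lemma l1_in_l2sq v B : l1_le v B -> (l2sq v <= (B ^+ 2)%:E)%E.
Proof.
move=> hv; apply: ge_ereal_sup => _ [A [finA _] <-].
rewrite fsbig_finite // sumEFin lee_fin.
apply: (@le_trans _ _ ((\sum_(X <- fset_set A) normc (v X)) ^+ 2)).
  elim: (enum_fset (fset_set A)) => [|X s IHs]; first by rewrite !big_nil expr0n.
  rewrite !big_cons (le_trans (lerD (lexx _) IHs)) // sqrrD addrAC lerDl.
  by rewrite mulrn_wge0 // mulr_ge0 ?normc_ge0 // sumr_ge0 // => Y _; exact: normc_ge0.
apply: lerXn2r; rewrite ?nnegrE ?(l1_le_ge0 hv) ?(hv _ (fset_uniq _)) //.
by rewrite sumr_ge0 // => X _; exact: normc_ge0.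
Qed.

Lemma l2sq_pointwise v X : ((normc (v X) ^+ 2)%:E <= l2sq v)%E.
Proof.
apply: esum_ge; exists [set X]; first by split => //; exact: finite_set1.
by rewrite fsbig_set1.
Qed.

Lemma l2sq_lt_sup v (e : R) : 0 < e -> (l2sq v < (e ^+ 2)%:E)%E ->
  forall X, normc (v X) <= e.
Proof.
move=> e0 hv X; have := le_lt_trans (l2sq_pointwise v X) hv; rewrite lte_fin.
by rewrite ltr_pXn2r ?nnegrE ?normc_ge0 ?(ltW e0) // => /ltW.
Qed.

Lemma in_l2_bounded v : in_l2 v -> exists M, forall X, normc (v X) <= M.
Proof.
rewrite /in_l2 => hv.
have l0 : (0 <= l2sq v)%E by apply: esum_ge0 => X _; rewrite lee_fin exprn_ge0 ?normc_ge0.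
have [l lE] : exists l : R, l2sq v = l%:E.
  by case: (l2sq v) hv l0 => // l _ _; exists l.
exists (1 + l) => X; have := l2sq_pointwise v X; rewrite lE lee_fin => h.
move: l0; rewrite lE lee_fin => l0.
have := normc_ge0 (v X); move: (normc (v X)) h => a h a0.
by have [a1|a1] := leP a 1; nra.
Qed.

End HamiltonianNorms.

(** * The Bethe formula solves the equation *)

Section BetheEvolution.
Variables (R : realType) (n : nat) (Delta r : R).
Hypothesis r_gt0 : 0 < r.
Hypothesis hpoles : poles_inside n.+1 Delta r.
Local Notation C := R[i].
Local Notation N := n.+1.
Local Notation H := (@Hxxz R N Delta).
Local Notation E := (@total_energy R N Delta).
Local Notation limit := (laurent_limit r (@predT ('I_N -> int))).
Local Notation integral := (@multi_circle_integral R r N).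
Local Notation bethe := (@bethe_function R N Delta r).
Implicit Types (X Y : config N) (g : ('I_N -> C) -> C) (y : 'I_N -> int).

Definition propagator (t : R) (xi : 'I_N -> C) : C := cexp (- 'i%C * t%:C * E xi).

Lemma limit_phase t : limit (fun xi => - 'i%C * t%:C * E xi).
Proof. by apply: (limitM r_gt0); [exact: laurent_limit_cst|exact: limit_energy]. Qed.

Lemma limit_propagator t : limit (propagator t).
Proof. by apply: laurent_limit_cexp => //; exact: limit_phase. Qed.

Lemma propagatorD s t xi : propagator (s + t) xi = propagator s xi * propagator t xi.
Proof. by rewrite /propagator -cexpD rmorphD mulrDr mulrDl. Qed.

Lemma propagator0 xi : propagator 0 xi = 1.
Proof. by rewrite /propagator rmorph0 mulr0 mul0r cexp0. Qed.

Lemma bethe_psiE Y t X :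
  bethe_psi Delta r Y t X = bethe (propagator t) (site X) (site Y).
Proof.
apply: eq_bigr => s _; congr (multi_circle_integral r _); apply/funext => xi.
rewrite /bethe_term -[RHS]mulrA; congr (_ * _); rewrite big_split /=; congr (_ * _).
by rewrite /propagator /total_energy mulr_sumr cexp_sum.
Qed.

Lemma limit_energyX g k : limit g -> limit (fun xi => g xi * E xi ^+ k).
Proof.
by move=> hg; apply: (limitM r_gt0) => //; apply: laurent_limitX => //; exact: limit_energy.
Qed.

(** The boundary relation holds for every factor [g], in particular for the powers
    of the energy. *)
Lemma iter_Hxxz_bethe g y k : limit g ->
  iter k H (fun Z => bethe g (site Z) y) = fun Z => bethe (fun xi => g xi * E xi ^+ k) (site Z) y.
Proof.
move=> hg; elim: k => [|k IHk].
  by under [in RHS]eq_fun do under eq_fun do rewrite expr0 mulr1.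
rewrite iterS IHk; apply/funext => X.
rewrite (Hxxz_extend (Phi := fun x => bethe (fun xi => g xi * E xi ^+ k) x y)); last first.
  by move=> i j ij xij; apply: (bethe_boundary_out r_gt0 hpoles ij) => //; exact: limit_energyX.
rewrite (bethe_function_out r_gt0 hpoles); last exact: limit_energyX.
have -> // : (fun xi => g xi * E xi ^+ k * E xi) = (fun xi => g xi * E xi ^+ k.+1).
by apply/funext => xi; rewrite exprSr mulrA.
Qed.

Lemma integral_remainder g s x y h m : limit g ->
  integral (bethe_term Delta (fun xi => g xi * propagator h xi) s x y) -
  \sum_(k < m) (divided_power k h)%:C * ((- 'i%C) ^+ k *
     integral (bethe_term Delta (fun xi => g xi * E xi ^+ k) s x y)) =
  integral (fun xi => bethe_term Delta g s x y xi *
     (propagator h xi - exp_partial m (- 'i%C * h%:C * E xi))).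
Proof.
move=> hg.
have hp : limit (bethe_term Delta (fun xi => g xi * propagator h xi) s x y).
  by apply: (limit_term r_gt0 hpoles); apply: (limitM r_gt0) => //; exact: limit_propagator.
have hk k : limit (bethe_term Delta (fun xi => g xi * E xi ^+ k) s x y).
  by apply: (limit_term r_gt0 hpoles); exact: limit_energyX.
pose c k : C := (divided_power k h)%:C * (- 'i%C) ^+ k.
have hck k : limit (fun xi => c k * bethe_term Delta (fun xi => g xi * E xi ^+ k) s x y xi).
  by apply: (limitM r_gt0) => //; exact: laurent_limit_cst.
under eq_bigr do rewrite mulrA -/(c _) -(multi_integralZ r_gt0) //.
rewrite -(multi_integral_sum r_gt0) // addrC -mulN1r.
rewrite -(multi_integral_linear r_gt0) //; last exact: laurent_limit_sum.
apply: eq_multi_integral => //.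
  apply: laurent_limitD => //; apply: (limitM r_gt0) => //; first exact: laurent_limit_cst.
  exact: laurent_limit_sum.
move=> xi T; rewrite mulrBr mulN1r addrC /bethe_term mulrA; congr (_ - _).
rewrite /exp_partial mulr_sumr; apply: eq_bigr => k _.
rewrite /c /divided_power !exprMn -rmorphXn /= rmorphM /=.
move: (Acoef _ _ _) (out_monomial _ _ _) (in_monomial _ _) (g xi) => a1 a2 a3 a4.
move: ((- 'i%C) ^+ k) (E xi ^+ k) ((h ^+ k)%:C) ((k`!%:R^-1)%:C) => b1 b2 b3 b4.
ring.
Qed.

(** The exponential series of the propagator converges uniformly on the torus, and
    the integrals of its terms are the powers of the Hamiltonian. *)
Lemma bethe_expansion g y h : limit g ->
  pointwise_limit (fun m => taylor H (- 'i%C) (fun Z => bethe g (site Z) y) m h)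
    (fun X => bethe (fun xi => g xi * propagator h xi) (site X) y).
Proof.
move=> hg X e e0.
have [B B0 hB] := laurent_limit_bounded r_gt0 (limit_phase h).
have hD s : {D | 0 < D & forall xi, torus r xi -> normc (bethe_term Delta g s (site X) y xi) <= D}.
  apply: cid2; apply: (laurent_limit_bounded r_gt0 (P := predT)).
  exact: (limit_term r_gt0 hpoles).
(* D s bounds the integrand of s, and the difference of the exponential and its
   partial sum is at most expR B times a term of the series of 2 * B *)
pose D s := s2val (hD s).
pose K := \sum_(s : 'S_N) (2 * r) ^+ N * (D s * expR B).
have K0 : 0 <= K.
  apply: sumr_ge0 => s _; rewrite !mulr_ge0 ?exprn_ge0 ?mulr_ge0 ?expR_ge0 ?(ltW r_gt0) //.
  exact: ltW (s2valP (hD s)).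
have eK : 0 < e / (K + 1) by rewrite divr_gt0 // ltr_wpDl.
have [n0 hn0] := divided_power_cvg0 (2 * B) eK.
exists n0 => m hm.
have -> : bethe (fun xi => g xi * propagator h xi) (site X) y -
    taylor H (- 'i%C) (fun Z => bethe g (site Z) y) m h X =
    \sum_(s : 'S_N) integral (fun xi => bethe_term Delta g s (site X) y xi *
     (propagator h xi - exp_partial m (- 'i%C * h%:C * E xi))).
  rewrite /taylor.
  under eq_bigr do rewrite iter_Hxxz_bethe // /bethe_function !mulr_sumr.
  rewrite exchange_big -sumrB; apply: eq_bigr => s _.
  exact: integral_remainder.
apply: (@le_trans _ _ (K * (e / (K + 1)))); last first.
  by rewrite mulrCA -[leRHS]mulr1 ler_wpM2l ?(ltW e0) // ler_pdivrMr ?ltr_wpDl // mul1r lerDl.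
apply: (@le_trans _ _ (\sum_(s : 'S_N) (2 * r) ^+ N * (D s * expR B * (e / (K + 1))))); last first.
  rewrite -[leRHS]/((\sum_(s : 'S_N) (2 * r) ^+ N * (D s * expR B)) * (e / (K + 1))).
  by rewrite [leRHS]mulr_suml; apply: ler_sum => s _; rewrite -[leRHS]mulrA.
rewrite (le_trans (normc_sum _ _ _)) //; apply: ler_sum => s _.
have limit_rem : limit (fun xi => propagator h xi - exp_partial m (- 'i%C * h%:C * E xi)).
  apply: laurent_limitD => //; first exact: limit_propagator.
  under eq_fun do rewrite -mulN1r.
  apply: (limitM r_gt0) => //; first exact: laurent_limit_cst.
  apply: laurent_limit_sum => // k _; apply: (limitM r_gt0); first exact: laurent_limit_cst.
  by apply: laurent_limitX => //; exact: limit_phase.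
apply: (normc_multi_integral r_gt0) => [|xi T].
  by apply: (limitM r_gt0) => //; exact: (limit_term r_gt0 hpoles).
rewrite ComplexField.Normc.normcM -[D s * _ * _]mulrA ler_pM ?normc_ge0 //.
  exact: (s2valP' (hD s) xi T).
apply: (le_trans (cexp_taylor _ _)).
have wB := hB xi T.
apply: ler_pM; rewrite ?expR_ge0 ?ler_expR ?divided_power_ge0 ?mulr_ge0 ?normc_ge0 //.
apply: le_trans (hn0 _ hm); apply: le_trans (ler_norm _).
rewrite /divided_power ler_pM2r ?invr_gt0 ?ltr0n ?fact_gt0 //.
by apply: lerXn2r; rewrite ?nnegrE ?mulr_ge0 ?normc_ge0 ?ler_pM2l // ltW.
Qed.

Variable Y : config N.
Local Notation f := (bethe_psi Delta r Y).

Lemma bethe_psi_expansion t h :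
  pointwise_limit (fun m => taylor H (- 'i%C) (f t) m h) (f (t + h)).
Proof.
have e1 : f t = fun Z => bethe (propagator t) (site Z) (site Y).
  by apply/funext => X; exact: bethe_psiE.
have e2 : f (t + h) = fun Z => bethe (fun xi => propagator t xi * propagator h xi) (site Z) (site Y).
  have -> : (fun xi => propagator t xi * propagator h xi) = propagator (t + h).
    by apply/funext => xi; rewrite propagatorD.
  by apply/funext => X; exact: bethe_psiE.
by rewrite e1 e2; apply: bethe_expansion; exact: limit_propagator.
Qed.

Lemma bethe_psi0 : f 0 = basis_vec R Y.
Proof.
apply/funext => X; rewrite bethe_psiE /basis_vec eq_sym -(bethe_initial r_gt0 hpoles).
have -> // : propagator 0 = fun=> 1.
by apply/funext => xi; exact: propagator0.
Qed.

Lemma normc_Ni : normc (- 'i%C : C) <= 1.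
Proof. by rewrite normc_opp normc_i. Qed.

Lemma bethe_psi_l1 t : exists B, l1_le (f t) B.
Proof.
have l1Y : l1_le (f 0) 1.
  rewrite bethe_psi0 => s us; rewrite /basis_vec.
  have [Ys|Ys] := boolP (Y \in s).
    rewrite (bigD1_seq Y) //= eqxx ComplexField.Normc.normc1 big1 ?addr0 // => X XY.
    by rewrite eq_sym (negPf XY) ComplexField.Normc.normc0.
  rewrite big1_seq ?ler01 // => X /andP[_ Xs].
  rewrite (_ : (Y == X) = false) ?ComplexField.Normc.normc0 //.
  by apply/eqP => YX; move: Ys; rewrite YX Xs.
exists (expR (Hnorm N Delta * `|t|) * 1).
have := bethe_psi_expansion 0 t; rewrite add0r => /l1_le_limit; apply => m.
exact: l1_le_taylor normc_Ni l1Y _.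
Qed.

Lemma bethe_psi_second_order t B h : l1_le (f t) B ->
  l1_le (fun X => f (t + h) X - (f t X + h%:C * (- 'i%C * H (f t) X)))
    (h ^+ 2 * (Hnorm N Delta ^+ 2 * expR (Hnorm N Delta * `|h|) * B)).
Proof.
move=> hB; apply: (@l1_le_limit _ _ (fun m X =>
  taylor H (- 'i%C) (f t) m.+2 h X - (f t X + h%:C * (- 'i%C * H (f t) X)))).
  move=> X e e0; have [n0 hn0] := bethe_psi_expansion t h X e0.
  exists n0 => m nm; have := hn0 m.+2 (leq_trans nm (leq_trans (leqnSn m) (leqnSn _))).
  have sub (a b c : C) : a - c - (b - c) = a - b by ring.
  by rewrite sub.
by move=> m; exact: l1_le_taylor2 normc_Ni hB m.
Qed.

(** The second order bound, divided by [s], is [O(|s|)] in l^1, hence in l^2. *)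
Lemma bethe_psi_derive t : is_l2_derive f t (fun X => - 'i%C * H (f t) X).
Proof.
have [B hB] := bethe_psi_l1 t.
have hd : l1_le (fun X => - 'i%C * H (f t) X) (normc (- 'i%C : C) * (Hnorm N Delta * B)).
  exact/l1_leZ/l1_le_H.
split; first by apply: le_lt_trans (l1_in_l2sq hd) _; rewrite ltry.
pose K := Hnorm N Delta ^+ 2 * expR (Hnorm N Delta) * B.
have Hn0 : 0 <= Hnorm N Delta by rewrite mulr_ge0 ?addr_ge0.
have B0 := l1_le_ge0 hB.
have hK (s : R) : s != 0 -> `|s| <= 1 ->
    l1_le (fun X => (s^-1)%:C * (f (t + s) X - f t X) - - 'i%C * H (f t) X) (`|s| * K).
  move=> s0 s1.
  have -> : (fun X => (s^-1)%:C * (f (t + s) X - f t X) - - 'i%C * H (f t) X) =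
      fun X => (s^-1)%:C * (f (t + s) X - (f t X + s%:C * (- 'i%C * H (f t) X))).
    have ss : (s^-1)%:C * s%:C = 1 :> C by rewrite -rmorphM /= mulVf.
    apply/funext => X; rewrite -[X in _ - X]mul1r -ss.
    by move: (f _ X) (f _ X) (_ * H _ X) => a b c; ring.
  have := l1_leZ (s^-1)%:C (bethe_psi_second_order s hB); apply: l1_leW.
  rewrite normc_real normfV -[s ^+ 2](real_normK (num_real s)) expr2 -[_ * _ * (_ * B)]mulrA.
  rewrite mulKf ?normr_eq0 // ler_wpM2l // ler_wpM2r // ler_wpM2l ?exprn_ge0 //.
  by rewrite ler_expR ler_piMr.
have K0 : 0 <= K by rewrite !mulr_ge0 ?exprn_ge0 ?expR_ge0.
apply: (squeeze_cvge (f := fun=> 0%E) (h := fun s => ((`|s| * K) ^+ 2)%:E)).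
- near=> s; apply/andP; split.
    by apply: esum_ge0 => X _; rewrite lee_fin exprn_ge0 ?normc_ge0.
  apply/l1_in_l2sq/hK; first by near: s; exact: nbhs_dnbhs_neq.
  by near: s; apply: dnbhs0_le.
- exact: cvg_cst.
- apply/fine_cvgP; split; first by near=> s.
  apply: (cvg_to_0_linear (K := K ^+ 2) (k := 1)) => // s /andP[_ s1] /=.
  rewrite normrX normrM normr_id (ger0_norm K0) exprMn mulrC.
  by rewrite ler_wpM2l ?exprn_ge0 // expr2 ler_piMr // ltW.
Unshelve. all: by end_near.
Qed.

Lemma bethe_psi_solution : schrodinger_solution Delta Y f.
Proof.
split=> [t|t|]; last exact: bethe_psi0.
  by have [B hB] := bethe_psi_l1 t; apply: le_lt_trans (l1_in_l2sq hB) _; rewrite ltry.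
exists (fun X => - 'i%C * H (f t) X); first exact: bethe_psi_derive.
by apply/funext => X; rewrite mulrA mulrN -expr2 sqr_i opprK mul1r.
Qed.

End BetheEvolution.

(** * Every solution is the limit of its Taylor polynomials *)

Section Uniqueness.
Variables (R : realType) (N : nat) (Delta : R).
Local Notation C := R[i].
Local Notation H := (@Hxxz R N Delta).
Implicit Types (X Y : config N) (Psi : R -> config N -> C).

Lemma l2_derive_near Psi t d : is_l2_derive Psi t d -> forall e, 0 < e ->
  \forall s \near (0 : R)^', forall X,
    normc ((s^-1)%:C * (Psi (t + s) X - Psi t X) - d X) <= e.
Proof.
move=> [_ hlim] e e0.
have e2 : (0 < (e ^+ 2)%:E :> \bar R)%E by rewrite lte_fin exprn_gt0.
have h : \forall s \near (0 : R)^', (l2sq (fun X =>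
    (s^-1)%:C * (Psi (t + s)%R X - Psi t X) - d X)%R < (e ^+ 2)%:E)%E.
  exact: hlim _ (open_ereal_lt' e2).
by near=> s => X; apply: (l2sq_lt_sup e0 _ X (v := fun X =>
  (s^-1)%:C * (Psi (t + s) X - Psi t X) - d X)); near: s.
Unshelve. all: by end_near.
Qed.

Lemma l2_derive_cderiv Psi t d X : is_l2_derive Psi t d -> cderiv (Psi ^~ X) t (d X).
Proof.
move=> hd.
have main (p : C -> R) : (forall z w, p (z - w) = p z - p w) ->
    (forall (a : R) z, p (a%:C * z) = a * p z) -> (forall z, `|p z| <= normc z) ->
    is_derive t 1 (fun s => p (Psi s X)) (p (d X)).
  move=> pB pZ ple.
  have lim : (fun s : R => s^-1 *: (((fun u => p (Psi u X)) \o shift t) (s *: 1) -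
      p (Psi t X))) @ 0^' --> p (d X).
    apply/cvgrPdist_le => e e0.
    have h := l2_derive_near hd e0; apply: filterS h => s /(_ X) hs.
    rewrite distrC /GRing.scale /= mulr1 [s + t]addrC -pB -pZ -pB.
    exact: le_trans (ple _) hs.
  by apply: DeriveDef; [apply: cvgP; exact: lim|apply: cvg_lim => //; exact: lim].
split; apply: main => [z w|a z|z]; rewrite ?ReD ?ReN ?ImD ?ImN ?ReZ ?ImZ //.
  exact: normc_Re.
exact: normc_Im.
Qed.

Lemma l2_derive_locally_bounded Psi t d : in_l2 (Psi t) -> is_l2_derive Psi t d ->
  exists M, \forall u \near t, forall X, normc (Psi u X) <= M.
Proof.
move=> ht hd; have [M0 hM0] := in_l2_bounded ht.
have [M1 hM1] := in_l2_bounded hd.1.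
exists (M0 + (M1 + 1)).
have near0 : \forall s \near (0 : R), forall X, normc (Psi (t + s) X) <= M0 + (M1 + 1).
  have h1 := l2_derive_near hd ltr01.
  have h2 : \forall s \near (0 : R)^', `|s| <= 1 by apply: dnbhs0_le.
  have h3 : \forall s \near (0 : R)^', forall X, normc (Psi (t + s) X) <= M0 + (M1 + 1).
    near=> s => X.
    have s0 : s != 0 by near: s; exact: nbhs_dnbhs_neq.
    have s1 : `|s| <= 1 by near: s.
    have hs : normc ((s^-1)%:C * (Psi (t + s) X - Psi t X) - d X) <= 1.
      by move: X; near: s.
    have ss : s%:C * (s^-1)%:C = 1 :> C by rewrite -rmorphM /= mulfV.
    have -> : Psi (t + s) X = Psi t X + s%:C * (d X +
        ((s^-1)%:C * (Psi (t + s) X - Psi t X) - d X)).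
      by rewrite [d X + _]addrC subrK mulrA ss mul1r [RHS]addrC subrK.
    rewrite (le_trans (ler_normcD _ _)) // lerD //.
    rewrite ComplexField.Normc.normcM normc_real -[leRHS]mul1r ler_pM ?normc_ge0 //.
    by rewrite (le_trans (ler_normcD _ _)) // lerD.
  move: h3; rewrite near_withinE => h3; apply: filterS h3 => s h3 X.
  have [->|s0] := eqVneq s 0; last exact: h3.
  rewrite addr0 (le_trans (hM0 X)) // lerDl.
  by rewrite (le_trans (normc_ge0 (d X))) // (le_trans (hM1 X)) // lerDl.
have c : (fun u : R => u - t) @ t --> (0 : R).
  by rewrite -(subrr t); exact: (cvgB cvg_id (cvg_cst t)).
have h : \forall u \near t, forall X, normc (Psi (t + (u - t)) X) <= M0 + (M1 + 1).
  exact: c _ near0.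
near=> u => X; have -> : u = t + (u - t) by rewrite addrC subrK.
by move: X; near: u.
Unshelve. all: by end_near.
Qed.

(** Near each time the solution is bounded uniformly in [X]; by compactness a
    single bound serves for the whole interval. *)
Lemma l2_derive_bounded Psi (T : R) :
  (forall t, in_l2 (Psi t)) -> (forall t, exists d, is_l2_derive Psi t d) ->
  exists M, forall t X, - T <= t <= T -> normc (Psi t X) <= M.
Proof.
move=> hin hder.
have /compact_near_coveringP cov := @segment_compact R (- T) T.
pose P (M t : R) := forall X, normc (Psi t X) <= M.
have [M hM] : exists M, forall t, - T <= t <= T -> P M t.
  have near_cov : \forall M \near +oo, `[- T, T]%classic `<=` P M.
    apply: cov => t _; have [d hd] := hder t.
    have [M0 hM0] := l2_derive_locally_bounded (hin t) hd.
    exists ([set u | forall X, normc (Psi u X) <= M0], [set M | M0 <= M]).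
      by split => //; apply: nbhs_pinfty_ge; exact: num_real.
    by move=> [u M] /= [hu hM] X; exact: le_trans (hu X) hM.
  have [M hM] := filter_ex near_cov.
  by exists M => t tT; apply: hM; rewrite /= in_itv.
by exists M => t X tT; exact: hM.
Qed.

(** For negative [t] time is reversed, which replaces [-i] with [i]; the Taylor
    polynomials are unchanged because [(i)^k |t|^k = (-i)^k t^k]. *)
Lemma solution_expansion Y Psi t : schrodinger_solution Delta Y Psi ->
  pointwise_limit (fun m => taylor H (- 'i%C) (basis_vec R Y) m t) (Psi t).
Proof.
move=> [hin hder h0] X e e0.
have hder' u : exists d, is_l2_derive Psi u d by have [d hd _] := hder u; exists d.
have [M hM] := l2_derive_bounded `|t| hin hder'.
have dPsi u Z : cderiv (Psi ^~ Z) u (- 'i%C * H (Psi u) Z).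
  have [d hd dE] := hder u.
  apply: (cderiv_eq (l2_derive_cderiv Z hd)).
  by rewrite -dE mulrA mulNr -expr2 sqr_i opprK mul1r.
pose sg : R := if 0 <= t then 1 else -1.
have sgt : sg * `|t| = t.
  by rewrite /sg; case: ger0P => _; rewrite ?mul1r ?mulN1r ?opprK.
have sg1 : `|sg| = 1 by rewrite /sg; case: ifP => _; rewrite ?normrN normr1.
pose kappa : C := sg%:C * - 'i%C.
have k1 : normc kappa <= 1.
  by rewrite ComplexField.Normc.normcM normc_real sg1 mul1r normc_opp normc_i.
pose Phi u := Psi (sg * u).
have dPhi u Z : cderiv (Phi ^~ Z) u (kappa * H (Phi u) Z).
  have [d1 d2] := dPsi (sg * u) Z.
  have dl : is_derive u 1 (fun s => sg * s) sg.
    rewrite (_ : (fun s => _) = sg \*: (@id R)) //.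
    by apply: is_derive_eq; rewrite /GRing.scale /= mulr1.
  split; rewrite /kappa -mulrA.
    by rewrite ReZ mulrC; exact: (is_derive1_comp (f := fun s => complex.Re (Psi s Z))).
  by rewrite ImZ mulrC; exact: (is_derive1_comp (f := fun s => complex.Im (Psi s Z))).
have bPhi u Z : 0 <= u <= `|t| -> normc (Phi u Z) <= M.
  move=> /andP[u0 ut]; apply: hM; rewrite -ler_norml normrM sg1 mul1r.
  by rewrite ger0_norm.
have tt : 0 <= `|t| <= `|t| by rewrite normr_ge0 lexx.
have M0 : 0 <= M by rewrite (le_trans (normc_ge0 (Phi `|t| X))) // bPhi.
have eM : 0 < e / (M + 1) by rewrite divr_gt0 // ltr_wpDl.
have [n0 hn0] := divided_power_cvg0 (2 * Hnorm N Delta * `|t|) eM.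
exists n0 => m hm.
have := taylor_bound (@Hxxz_linear _ _ _) (@Hxxz_sup_bound _ _ _) k1 dPhi bPhi m X tt.
rewrite {1}/Phi sgt {1}/Phi mulr0 h0.
have -> : taylor H kappa (basis_vec R Y) m `|t| X = taylor H (- 'i%C) (basis_vec R Y) m t X.
  apply: eq_bigr => k _; rewrite /kappa exprMn -rmorphXn /= !mulrA; congr (_ * _ * _).
  rewrite -rmorphM; congr (_%:C).
  by rewrite /divided_power -[in RHS]sgt exprMn mulrC mulrA.
move=> /le_trans; apply.
apply: (@le_trans _ _ (M * (e / (M + 1)))).
  rewrite -mulrA ler_wpM2l //; apply: le_trans (hn0 _ hm); apply: le_trans (ler_norm _).
  by rewrite /divided_power [(2 * Hnorm N Delta * _) ^+ m]exprMn mulrA.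
by rewrite mulrCA -[leRHS]mulr1 ler_wpM2l ?(ltW e0) // ler_pdivrMr ?ltr_wpDl // mul1r lerDl.
Qed.

End Uniqueness.

Theorem mainTheorem1 (R : realType) (N : nat) (Delta : R) (Y : config N)
    (r : R) (hN : (1 <= N)%N) (hr : 0 < r)
    (hpoles : poles_inside N Delta r) :
  schrodinger_solution Delta Y (bethe_psi Delta r Y) /\
  (forall Psi : R -> config N -> R[i],
     schrodinger_solution Delta Y Psi ->
     forall (X : config N) (t : R), Psi t X = bethe_psi Delta r Y t X).
Proof.
case: N Y hN hpoles => // n Y _ hpoles.
have bethe_sol := bethe_psi_solution hr hpoles Y.
split => // Psi sol X t.
exact: pointwise_limit_unique (solution_expansion t sol) (solution_expansion t bethe_sol) X.
Qed.
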